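(* Let $p$ be an odd prime, $e\ge 1$, $q=p^e$, and let $\mathcal{NP}$ be the regular nearfield plane of order $q^2$ described in the context. Let $U$ be a parabolic unital of order $q$ in $\mathcal{NP}$ containing the point $(0,1,0)$ or the point $(1,0,0)$, and suppose that the group $\mathrm{Aut}(U)\cap\mathfrak{L}$ of linear collineations of $\mathcal{NP}$ mapping $U$ onto itself has order $q(q^2-1)$. Then $U$ is projectively equivalent (i.e. mapped by some collineation of $\mathcal{NP}$) to the set $$\{(x,\mathrm{Nm}(x)+t\epsilon,1)\,:\, x\in\mathbb{F}_{q^2},\ t\in\mathbb{F}_q\}\cup\{(0,1,0)\},$$ where $\epsilon\in\mathbb{F}_{q^2}^{*}$ satisfies $\epsilon^q=-\epsilon$ and $\mathrm{Nm}(x)=x^{q+1}$.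
   Context: Nearfield: the regular nearfield $\mathcal N=\mathcal N(2,q)$ has underlying set $\mathbb{F}_{q^2}$, field addition, and multiplication $x\star y=xy$ if $y$ is a nonzero square of $\mathbb{F}_{q^2}$, $x\star y=x^qy$ if $y$ is a nonsquare of $\mathbb{F}_{q^2}$, and $x\star 0=0$; $(\mathbb{F}_{q^2}^*,\star)$ is a group. Plane $\mathcal{NP}$: points are $(x,y,1)$ with $x,y\in\mathbb{F}_{q^2}$ (affine points), $(1,y,0)$ with $y\in\mathbb{F}_{q^2}$, and $(0,1,0)$; lines are $[s,1,t]$, $[1,0,t]$ ($s,t\in\mathbb{F}_{q^2}$) and $[0,0,1]$ (the line at infinity); $(x,y,z)$ is incident with $[s,u,t]$ iff $x\star s+y\star u+z\star t=0$. This is a projective plane of order $q^2$. For $c,d\in\mathbb{F}_{q^2}^*$ and $u,v\in\mathbb{F}_{q^2}$, $\phi(c,d,u,v)$ denotes the collineation of $\mathcal{NP}$ acting on affine points by $(x,y,1)\mapsto(x\star c+u,\,y\star d+v,1)$, and $\gamma(c,d,u,v)$ the collineation acting by $(x,y,1)\mapsto(y\star c+u,\,x\star d+v,1)$ (each extends uniquely to the whole plane). The group of linear collineations is $\mathfrak{L}=\{\phi(c,d,u,v)\}\cup\{\gamma(c,d,u,v)\}$. A unital of order $q$ in $\mathcal{NP}$ is a set of $q^3+1$ points meeting every line in $1$ point (tangent) or $q+1$ points (secant); it is parabolic if $[0,0,1]$ is a tangent. $\mathrm{Aut}(U)$ is the group of collineations of $\mathcal{NP}$ mapping $U$ onto itself.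 *)

(* Defs.v *)
From HB Require Import structures.
From mathcomp Require Import all_boot all_fingroup all_algebra.

Set Implicit Arguments.
Unset Strict Implicit.
Unset Printing Implicit Defensive.

Import GRing.Theory.
Local Open Scope ring_scope.

(* In all definitions taking [q] and [F], the intended situation is
   #|F| = q ^ 2 with q odd, so that x |-> x ^+ q is the involutory
   automorphism of F and its fixed field is the subfield of order q. *)

Definition is_square (F : finFieldType) (y : F) : bool :=
  [exists z : F, y == z ^+ 2].

Definition nmul (q : nat) (F : finFieldType) (x y : F) : F :=
  if y == 0 then 0 else if is_square y then x * y else x ^+ q * y.

Definition is_point (F : finFieldType) (P : F * F * F) : bool :=
  let: (x, y, z) := P in
  [|| z == 1, (z == 0) && (x == 1) | [&& z == 0, x == 0 & y == 1]].

Definition is_line (F : finFieldType) (L : F * F * F) : bool :=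
  let: (s, u, t) := L in
  [|| u == 1, (u == 0) && (s == 1) | [&& u == 0, s == 0 & t == 1]].

Record point (F : finFieldType) : Type :=
  Point { pcoords : F * F * F; _ : is_point pcoords }.

HB.instance Definition _ (F : finFieldType) := [isSub for @pcoords F].
HB.instance Definition _ (F : finFieldType) := [Equality of point F by <:].
HB.instance Definition _ (F : finFieldType) := [Choice of point F by <:].
HB.instance Definition _ (F : finFieldType) := [Countable of point F by <:].
HB.instance Definition _ (F : finFieldType) := [Finite of point F by <:].

Record line (F : finFieldType) : Type :=
  Line { lcoords : F * F * F; _ : is_line lcoords }.

HB.instance Definition _ (F : finFieldType) := [isSub for @lcoords F].
HB.instance Definition _ (F : finFieldType) := [Equality of line F by <:].
HB.instance Definition _ (F : finFieldType) := [Choice of line F by <:].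
HB.instance Definition _ (F : finFieldType) := [Countable of line F by <:].
HB.instance Definition _ (F : finFieldType) := [Finite of line F by <:].

Fact affine_subproof (F : finFieldType) (x y : F) : is_point (x, y, 1).
Proof. by rewrite /= eqxx. Qed.

Definition affine (F : finFieldType) (x y : F) : point F :=
  Point (affine_subproof x y).

Fact inf_subproof (F : finFieldType) (y : F) : is_point (1, y, 0).
Proof. by rewrite /= !eqxx orbT. Qed.

Definition inf_point (F : finFieldType) (y : F) : point F :=
  Point (inf_subproof y).

Fact inf_vert_subproof (F : finFieldType) : is_point (0 : F, 1 : F, 0 : F).
Proof. by rewrite /= !eqxx !orbT. Qed.

Definition inf_vert (F : finFieldType) : point F :=
  Point (inf_vert_subproof F).

Fact inf_line_subproof (F : finFieldType) : is_line (0 : F, 0 : F, 1 : F).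
Proof. by rewrite /= !eqxx !orbT. Qed.

Definition inf_line (F : finFieldType) : line F :=
  Line (inf_line_subproof F).

Definition incident (q : nat) (F : finFieldType) (P : point F) (L : line F) :
    bool :=
  let: (x, y, z) := pcoords P in
  let: (s, u, t) := lcoords L in
  nmul q x s + nmul q y u + nmul q z t == 0.

Definition points_on (q : nat) (F : finFieldType) (L : line F) :
    {set point F} :=
  [set P | incident q P L].

(* A collineation is represented by its action on points, which determines its
   action on lines.  Since there are finitely many lines, a permutation of the
   points mapping every line onto a line permutes the lines. *)
Definition collineations (q : nat) (F : finFieldType) :
    {set {perm point F}} :=
  [set g : {perm point F} |
    [forall L : line F, [exists M : line F,
       g @: points_on q L == points_on q M]]].

Definition acts_as_phi (q : nat) (F : finFieldType) (c d u v : F)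
    (g : {perm point F}) : bool :=
  [forall x : F, [forall y : F,
     g (affine x y) == affine (nmul q x c + u) (nmul q y d + v)]].

Definition acts_as_gamma (q : nat) (F : finFieldType) (c d u v : F)
    (g : {perm point F}) : bool :=
  [forall x : F, [forall y : F,
     g (affine x y) == affine (nmul q y c + u) (nmul q x d + v)]].

Definition linear_collineations (q : nat) (F : finFieldType) :
    {set {perm point F}} :=
  [set g in collineations q F |
    [exists c : F, [exists d : F, [exists u : F, [exists v : F,
      [&& c != 0, d != 0 &
          acts_as_phi q c d u v g || acts_as_gamma q c d u v g]]]]]].

Definition tangent (q : nat) (F : finFieldType) (U : {set point F})
    (L : line F) : bool :=
  #|U :&: points_on q L| == 1%N.

Definition secant (q : nat) (F : finFieldType) (U : {set point F})
    (L : line F) : bool :=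
  #|U :&: points_on q L| == q.+1.

Definition unital (q : nat) (F : finFieldType) (U : {set point F}) : Prop :=
  #|U| = (q ^ 3).+1 /\ forall L : line F, tangent q U L \/ secant q U L.

Definition parabolic_unital (q : nat) (F : finFieldType)
    (U : {set point F}) : Prop :=
  unital q U /\ tangent q U (inf_line F).

Definition Aut_set (q : nat) (F : finFieldType) (U : {set point F}) :
    {set {perm point F}} :=
  [set g in collineations q F | g @: U == U].

Definition proj_equiv (q : nat) (F : finFieldType) (U V : {set point F}) :
    Prop :=
  exists2 g : {perm point F}, g \in collineations q F & g @: U = V.

Definition Nm (q : nat) (F : finFieldType) (x : F) : F := x ^+ q.+1.

(* The parameter t ranges over the subfield of order q. *)
Definition model_unital (q : nat) (F : finFieldType) (eps : F) :
    {set point F} :=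
  [set affine x (Nm q x + t * eps) | x in [set: F], t in [set t : F | t ^+ q == t]]
    :|: [set inf_vert F].

(* Main.v *)
(* Up to swapping the coordinates, inf_vert lies on U; then each vertical line
   meets U in exactly q affine points, and the linear collineations fixing U are
   maps (x, y) |-> (x * c + u, y * d + v).  Homologies with centre inf_vert are
   excluded because their axis would lie in U, so counting forces the group to
   consist of q translations along a subgroup V of the y-axis and, after moving
   the origin, one map (x, y) |-> (x * c, y * d(c)) for every c <> 0; moreover
   d(c) = 1 for exactly q + 1 values of c.  The multipliers of V then
   exhaust F_q, so V is an F_q-line, U is a union of cosets of V, and U is described by
   a function f from F to F / V = F_q.

   Every F_q-linear functional of F arises from exactly one slope, so the graph of
   f is an ovoid of PG(3, q), and Segre's theorem makes f quadratic on every
   F_q-line.  For q > 3 some c outside F_q with d(c) = 1 acts on f by ordinary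
   multiplication, and an invariant quadratic form is a multiple of the norm.
   For q = 3 the level sets of f off 0 are the cosets of a cyclic subgroup
   of order 4 of Q8, and an automorphism of the nearfield carries it to the squares. *)
Require Import Defs.
From mathcomp Require Import all_boot all_fingroup all_algebra.
From mathcomp Require Import finfield.
From mathcomp Require Import ring zify.
Set Implicit Arguments.
Unset Strict Implicit.
Unset Printing Implicit Defensive.
Import GRing.Theory.
Local Open Scope ring_scope.

(** The obstacle is the twist: [x ⋆ m] is additive in [x] but not in [m], and for nonsquare [m] it
    is not F-linear in [x] either. The passage to PG(3, q) survives because conjugation can be moved
    across the trace, Tr(k x^q m) = Tr(k^q m^q x), and because the square class of the resulting
    coefficient still reveals that of [m]. Hence distinct slopes give distinct functionals, and
    counting gives them all.

    Ovoids enter only through functions on lines of F: three collinear points are excluded by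
    counting, and Segre's argument then yields a quadratic polynomial in the line parameter.
    Comparing coefficients of such polynomials takes four elements of F_q.

    This is one reason why q = 3 stands apart. The other lies in the group of all c with d(c) = 1:
    at least (q + 1) / 2 of its elements are squares, and these act by ordinary multiplication, but
    for q = 3 they may be just 1 and -1. Indeed Q8 has three cyclic subgroups of order 4, only one
    of which consists of the squares. *)

(** * Counting in finite sets and fields *)

Lemma card_uniform_fibers (T T' : finType) (X : {set T}) (f : T -> T') k :
  (forall t, t \in X -> #|[set s in X | f s == f t]| = k) ->
  #|X| = (k * #|f @: X|)%N.
Proof.
move=> fibk; rewrite -sum1_card (partition_big_imset f) /=.
transitivity (\sum_(y in f @: X) k)%N; last by rewrite sum_nat_const mulnC.
apply: eq_bigr => y /imsetP[t tX ->].
by rewrite -(fibk t tX) -sum1_card; apply: eq_bigl => s; rewrite !inE.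
Qed.

Lemma card_le_fibers (T T' : finType) (X : {set T}) (Y : {set T'}) (f : T -> T') k :
  (forall t, t \in X -> f t \in Y) ->
  (forall y, y \in Y -> #|[set s in X | f s == y]| <= k)%N ->
  (#|X| <= k * #|Y|)%N.
Proof.
move=> fY fibk.
have -> : #|X| = (\sum_(y in Y) #|[set s in X | f s == y]|)%N.
  rewrite -sum1_card (partition_big f (mem Y)) //=.
  by apply: eq_bigr => y _; rewrite -sum1_card; apply: eq_bigl => s; rewrite !inE.
rewrite mulnC -sum_nat_const; exact: leq_sum.
Qed.

Lemma eq_of_subset_leq_card (T : finType) (A B : {set T}) :
  A \subset B -> (#|B| <= #|A|)%N -> A = B.
Proof. by move=> sAB leBA; apply/eqP; rewrite eqEcard sAB leBA. Qed.

Lemma card_setD1 (T : finType) (A : {set T}) (a : T) :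
  a \in A -> #|A :\ a| = #|A|.-1.
Proof. by move=> aA; rewrite (cardsD1 a A) aA. Qed.

Lemma card_roots_le (F : finFieldType) (P : {poly F}) (A : {set F}) :
  P != 0 -> (forall x, x \in A -> root P x) -> (#|A| < size P)%N.
Proof.
move=> P0 rA; rewrite cardE; apply: max_poly_roots => //; last exact: enum_uniq.
by apply/allP => x; rewrite mem_enum; apply: rA.
Qed.


Lemma card_exp_le (F : finFieldType) (n : nat) (a : F) :
  (0 < n)%N -> (#|[set x : F | x ^+ n == a]| <= n)%N.
Proof.
move=> n0; rewrite -ltnS -(size_XnsubC a n0); apply: card_roots_le.
  by rewrite -size_poly_eq0 size_XnsubC.
by move=> x; rewrite inE /root !hornerE subr_eq0.
Qed.

(** * Square classes and nearfield arithmetic *)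

Section Nearfield.
Variables (p e q : nat) (F : finFieldType).
Hypotheses (hp : prime p) (hp_odd : odd p) (he : (1 <= e)%N).
Hypotheses (hq : q = (p ^ e)%N) (hF : #|F| = (q ^ 2)%N).

Local Notation "x ⋆ y" := (nmul q x y) (at level 40, left associativity).

Lemma q_odd : odd q. Proof. by rewrite hq oddX hp_odd orbT. Qed.

Lemma q_ge3 : (3 <= q)%N.
Proof.
have p3 : (3 <= p)%N by case: p hp hp_odd => [|[|[|[]]]].
by rewrite hq (leq_trans p3) // -{1}(expn1 p) leq_exp2l // prime_gt1.
Qed.

Lemma q_gt0 : (0 < q)%N. Proof. by rewrite (leq_trans _ q_ge3). Qed.

Lemma q_lt_sq : (q.+1 < q ^ 2)%N.
Proof. by have := q_ge3; rewrite -mulnn; nia. Qed.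

Lemma pcharF : p \in [pchar F].
Proof. by apply: (@card_finPcharP _ p (e * 2)); rewrite // hF hq expnM. Qed.

Lemma frobD (x y : F) : (x + y) ^+ q = x ^+ q + y ^+ q.
Proof. by rewrite hq exprDn_pchar // pnatX (pnatE _ hp) pcharF. Qed.

Lemma exp_card (x : F) : x ^+ (q ^ 2) = x.
Proof. by rewrite -hF expf_card. Qed.

Lemma frobK (x : F) : (x ^+ q) ^+ q = x.
Proof. by rewrite -exprM mulnn exp_card. Qed.

Lemma frob0 : (0 : F) ^+ q = 0.
Proof. by rewrite expr0n (gtn_eqF q_gt0). Qed.

Lemma frobN (x : F) : (- x) ^+ q = - x ^+ q.
Proof. by rewrite exprNn -signr_odd q_odd expr1 mulN1r. Qed.

Lemma frobB (x y : F) : (x - y) ^+ q = x ^+ q - y ^+ q.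
Proof. by rewrite frobD frobN. Qed.

Lemma frob_eq0 (x : F) : (x ^+ q == 0) = (x == 0).
Proof. by rewrite expf_eq0 q_gt0. Qed.

Lemma frob_inj : injective (fun x : F => x ^+ q).
Proof. by move=> x y /= exy; rewrite -(frobK x) exy frobK. Qed.

Lemma two_neq0 : (2 : F) != 0.
Proof.
rewrite -(dvdn_pcharf pcharF) gtnNdvd //.
by case: p hp hp_odd => [|[|[|[]]]].
Qed.

Lemma frob2 : (2 : F) ^+ q = 2.
Proof. by rewrite -[2]/(1 + 1) frobD expr1n. Qed.

Lemma card_nz : #|[set~ (0 : F)]| = (q ^ 2).-1.
Proof. by rewrite cardsC1 hF. Qed.

Lemma prod_nz (A : {set F}) : 0 \notin A -> \prod_(x in A) x != 0.
Proof. by move=> A0; apply/prodf_neq0 => x xA; apply: contraNneq A0 => <-. Qed.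

(** Multiplication by [c] permutes [A], so the product of [A], which is nonzero, equals itself times
    [c ^+ #|A|]. *)
Lemma expr_card_stable (A : {set F}) (c : F) :
  c != 0 -> 0 \notin A -> (forall x, x \in A -> x * c \in A) -> c ^+ #|A| = 1.
Proof.
move=> c0 A0 AcA; have P0 := prod_nz A0; apply: (mulfI P0); rewrite mulr1.
have cA : [set x * c | x in A] = A.
  apply: eq_of_subset_leq_card; first by apply/subsetP => _ /imsetP[x xA ->]; apply: AcA.
  by rewrite card_imset //; apply: mulIf.
rewrite -{3}cA big_imset /=; last by move=> x y _ _; apply: mulIf.
by rewrite big_split /= prodr_const.
Qed.

Definition euler_exp := (q ^ 2).-1./2.
Local Notation h := euler_exp.

Lemma hE : (h * 2)%N = (q ^ 2).-1.
Proof.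
rewrite /euler_exp -(odd_double_half q) q_odd; set k := q./2.
have -> : ((1 + k.*2) ^ 2).-1 = (2 * k * k.+1).*2 by rewrite -mulnn -!muln2; nia.
by rewrite doubleK muln2.
Qed.

Lemma h_gt0 : (0 < h)%N.
Proof.
have := hE; have : (8 < q ^ 2)%N by rewrite (@leq_trans (3 ^ 2)) // leq_sqr q_ge3.
by case: (h) => //; case: (q ^ 2)%N => // -[].
Qed.

Lemma exp_nz (x : F) : x != 0 -> x ^+ (q ^ 2).-1 = 1.
Proof.
move=> xn0; apply: (mulfI xn0); rewrite mulr1 -exprS prednK ?exp_card //.
by rewrite expn_gt0 q_gt0.
Qed.

(** Squaring is at most two-to-one, so there are at least [h] nonzero squares, while there are at
    most [h] roots of unity of exponent [h]. *)
Lemma squares_Euler :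
  [set x ^+ 2 | x in [set~ (0 : F)]] = [set x : F | x ^+ h == 1].
Proof.
apply: eq_of_subset_leq_card.
  apply/subsetP => y /imsetP[x]; rewrite !inE => x0 ->.
  by rewrite -exprM mulnC hE exp_nz.
apply: leq_trans (card_exp_le _ h_gt0) _.
rewrite -(leq_pmul2l (isT : 0 < 2)%N) mulnC hE -card_nz.
apply: (card_le_fibers (f := fun x => x ^+ 2)) => [x xn|y _].
  by apply/imsetP; exists x.
apply: leq_trans (card_exp_le y (isT : 0 < 2)%N).
by apply/subset_leq_card/subsetP => x; rewrite !inE => /andP[].
Qed.

Lemma is_squareE (x : F) : x != 0 -> is_square x = (x ^+ h == 1).
Proof.
move=> x0; have := squares_Euler => /setP/(_ x); rewrite !inE => <-.
apply/existsP/imsetP => [[z /eqP ez]|[z _ ->]]; last by exists z.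
exists z => //; rewrite !inE; apply: contra_neq x0 => z0.
by rewrite ez z0 expr0n.
Qed.

Lemma is_square0 : is_square (0 : F).
Proof. by apply/existsP; exists 0; rewrite expr0n. Qed.

Lemma Euler_pm (x : F) : x != 0 -> x ^+ h = (-1) ^+ (~~ is_square x).
Proof.
move=> x0; rewrite is_squareE //; case: eqP => [//|/eqP n1 /=]; rewrite expr1.
have /eqP : (x ^+ h) ^+ 2 = 1 by rewrite -exprM hE exp_nz.
by rewrite sqrf_eq1 (negPf n1) => /eqP.
Qed.

Lemma one_neqN1 : (-1 : F) != 1.
Proof.
apply: contraNneq two_neq0 => e1; have -> : (2 : F) = 1 - (-1) by ring.
by rewrite e1 subrr.
Qed.

Lemma is_squareM (x y : F) : x != 0 -> y != 0 ->
  is_square (x * y) = (is_square x == is_square y).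
Proof.
move=> x0 y0; rewrite is_squareE ?mulf_neq0 // exprMn !Euler_pm //.
case: (is_square x); case: (is_square y);
  by rewrite /= ?mulN1r ?mul1r ?mulr1 ?opprK ?eqxx ?(negPf one_neqN1).
Qed.

Lemma is_squareX2 (x : F) : is_square (x ^+ 2).
Proof. by apply/existsP; exists x. Qed.

Lemma is_square1 : is_square (1 : F).
Proof. by rewrite -(expr1n _ 2) is_squareX2. Qed.

Lemma is_square_frob (x : F) : is_square (x ^+ q) = is_square x.
Proof.
by apply/existsP/existsP => -[z /eqP ez]; exists (z ^+ q); apply/eqP;
  rewrite -exprM mulnC exprM -ez ?frobK.
Qed.

Lemma is_squareV (x : F) : is_square x^-1 = is_square x.
Proof.
by apply/existsP/existsP => -[z /eqP ez]; exists z^-1;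
  rewrite exprVn -ez ?invrK.
Qed.

(** As q + 1 is even, the Euler exponent is a multiple of q - 1. In particular -1 is a square, so
    negation respects the twist. *)
Lemma is_square_Fq (t : F) : t ^+ q = t -> is_square t.
Proof.
have [-> _|t0 tq] := eqVneq t 0; first exact: is_square0.
rewrite is_squareE //.
have -> : h = (q.-1 * q.+1./2)%N.
  have := hE; have := q_odd; have := q_gt0; case: (q) => // n _ /= no hh.
  have : (uphalf n.+1 * 2)%N = n.+2.
    by rewrite muln2 -[RHS]odd_double_half /= negbK (negPf no).
  nia.
rewrite exprM (_ : t ^+ q.-1 = 1) ?expr1n //.
by apply: (mulfI t0); rewrite mulr1 -exprS prednK ?q_gt0.
Qed.

(** As q - 1 is even, the Euler exponent is also a multiple of q + 1. *)
Lemma is_square_norm1 (d : F) : d ^+ q.+1 = 1 -> is_square d.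
Proof.
move=> d1; have d0 : d != 0.
  by apply: contra_eq_neq d1 => ->; rewrite expr0n eq_sym oner_eq0.
rewrite is_squareE //; suff -> : h = (q.+1 * q.-1./2)%N by rewrite exprM d1 expr1n.
have := hE; have := q_odd; have := q_gt0; case: (q) => // n _ /= no hh.
have : (n./2 * 2)%N = n by rewrite muln2 -[RHS]odd_double_half (negPf no).
nia.
Qed.

Lemma is_squareN (x : F) : is_square (- x) = is_square x.
Proof.
have [->|x0] := eqVneq x 0; first by rewrite oppr0.
rewrite -mulN1r is_squareM ?oppr_eq0 ?oner_eq0 //.
by rewrite (is_square_Fq (_ : (-1) ^+ q = -1)) // frobN expr1n.
Qed.

Lemma nmulE (x y : F) : x ⋆ y = (if is_square y then x else x ^+ q) * y.
Proof.
rewrite /nmul; have [->|//] := eqVneq y 0; first by rewrite mulr0.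
by case: ifP.
Qed.

Lemma nmulDl (x y z : F) : (x + y) ⋆ z = x ⋆ z + y ⋆ z.
Proof. by rewrite !nmulE; case: ifP => _; rewrite ?frobD mulrDl. Qed.
Lemma nmulNl (x z : F) : (- x) ⋆ z = - (x ⋆ z).
Proof. by rewrite !nmulE; case: ifP => _; rewrite ?frobN mulNr. Qed.
Lemma nmulBl (x y z : F) : (x - y) ⋆ z = x ⋆ z - y ⋆ z.
Proof. by rewrite nmulDl nmulNl. Qed.
Lemma nmul0 (x : F) : x ⋆ 0 = 0.
Proof. by rewrite nmulE mulr0. Qed.
Lemma n0mul (x : F) : 0 ⋆ x = 0.
Proof. by rewrite nmulE frob0 if_same mul0r. Qed.
Lemma nmul1 (x : F) : x ⋆ 1 = x.
Proof. by rewrite nmulE is_square1 mulr1. Qed.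
Lemma n1mul (x : F) : 1 ⋆ x = x.
Proof. by rewrite nmulE expr1n if_same mul1r. Qed.
Lemma nmulrN (x y : F) : x ⋆ (- y) = - (x ⋆ y).
Proof. by rewrite !nmulE is_squareN mulrN. Qed.

Lemma nmul_eq0 (x y : F) : (x ⋆ y == 0) = (x == 0) || (y == 0).
Proof. by rewrite nmulE mulf_eq0; case: ifP => _; rewrite ?frob_eq0. Qed.

(** Conjugation preserves square classes, so the twist is a homomorphism to the Galois group;
    associativity of [nmul] rests on this. *)
Lemma is_square_nmul (x y : F) : x != 0 -> y != 0 ->
  is_square (x ⋆ y) = (is_square x == is_square y).
Proof.
move=> x0 y0; rewrite nmulE is_squareM //; last by case: ifP; rewrite ?frob_eq0.
by case: (is_square y); rewrite ?is_square_frob.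
Qed.

Lemma nmulA (x y z : F) : x ⋆ (y ⋆ z) = x ⋆ y ⋆ z.
Proof.
have [->|y0] := eqVneq y 0; first by rewrite n0mul !nmul0 n0mul.
have [->|z0] := eqVneq z 0; first by rewrite !nmul0.
rewrite [LHS]nmulE is_square_nmul // !nmulE.
by case: (is_square y); case: (is_square z) => /=; rewrite ?exprMn ?frobK mulrA.
Qed.

Lemma nmulIl (z : F) : z != 0 -> injective (fun x => x ⋆ z).
Proof.
move=> z0 x y /eqP; rewrite -subr_eq0 -nmulBl nmul_eq0 (negPf z0) orbF subr_eq0.
by move=> /eqP.
Qed.

(** [nmul] is not additive in its second argument, so differences are of no use. Instead the product
    reveals the square class of that argument, hence whether [x] was conjugated. *)
Lemma nmulIr (x : F) : x != 0 -> injective (fun y => x ⋆ y).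
Proof.
move=> x0 y z /= exyz.
have [y0|y0] := eqVneq y 0.
  by move/esym/eqP: exyz; rewrite y0 nmul0 nmul_eq0 (negPf x0) => /eqP.
have [z0|z0] := eqVneq z 0.
  by move/eqP: exyz; rewrite z0 nmul0 nmul_eq0 (negPf x0) (negPf y0).
have : is_square y = is_square z.
  have := is_square_nmul x0 y0; rewrite exyz is_square_nmul //.
  by case: (is_square x); case: (is_square y); case: (is_square z).
move=> syz; move: exyz; rewrite !nmulE syz; apply: mulfI.
by case: ifP; rewrite ?frob_eq0.
Qed.

(** A nonsquare has a nonsquare inverse, and a nonsquare right factor conjugates the left one. *)
Definition ninv (x : F) : F := if is_square x then x^-1 else x ^- q.

Lemma ninv_eq0 (x : F) : (ninv x == 0) = (x == 0).
Proof. by rewrite /ninv; case: ifP; rewrite invr_eq0 ?frob_eq0. Qed.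

Lemma is_square_ninv (x : F) : is_square (ninv x) = is_square x.
Proof. by rewrite /ninv; case: ifP => sx; rewrite is_squareV ?is_square_frob. Qed.

Lemma nmulV (x : F) : x != 0 -> x ⋆ ninv x = 1.
Proof.
move=> x0; rewrite nmulE is_square_ninv /ninv; case: ifP => _; rewrite ?mulfV //.
by rewrite frob_eq0.
Qed.

Lemma nVmul (x : F) : x != 0 -> ninv x ⋆ x = 1.
Proof.
move=> x0; have v0 : ninv x != 0 by rewrite ninv_eq0.
by apply: (nmulIr x0); rewrite /= nmulA nmulV // n1mul nmul1.
Qed.

Lemma nmulVK (x y : F) : y != 0 -> x ⋆ ninv y ⋆ y = x.
Proof. by move=> y0; rewrite -nmulA nVmul // nmul1. Qed.

Lemma nmulKV (x y : F) : y != 0 -> x ⋆ y ⋆ ninv y = x.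
Proof. by move=> y0; rewrite -nmulA nmulV // nmul1. Qed.

(** * The subfield of order q, trace and norm *)

Definition Fq : {set F} := [set t : F | t ^+ q == t].

Lemma FqP (t : F) : reflect (t ^+ q = t) (t \in Fq).
Proof. by rewrite inE; apply: eqP. Qed.

Lemma Fq0 : 0 \in Fq. Proof. by rewrite inE frob0. Qed.
Lemma Fq1 : 1 \in Fq. Proof. by rewrite inE expr1n. Qed.
Lemma FqD (x y : F) : x \in Fq -> y \in Fq -> x + y \in Fq.
Proof. by move=> /FqP hx /FqP hy; apply/FqP; rewrite frobD hx hy. Qed.
Lemma FqN (x : F) : x \in Fq -> - x \in Fq.
Proof. by move=> /FqP hx; apply/FqP; rewrite frobN hx. Qed.
Lemma FqB (x y : F) : x \in Fq -> y \in Fq -> x - y \in Fq.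
Proof. by move=> hx hy; rewrite FqD ?FqN. Qed.
Lemma FqM (x y : F) : x \in Fq -> y \in Fq -> x * y \in Fq.
Proof. by move=> /FqP hx /FqP hy; apply/FqP; rewrite exprMn hx hy. Qed.
Lemma FqV (x : F) : x \in Fq -> x^-1 \in Fq.
Proof. by move=> /FqP hx; apply/FqP; rewrite exprVn hx. Qed.
Lemma Fq_div (x y : F) : x \in Fq -> y \in Fq -> x / y \in Fq.
Proof. by move=> hx hy; rewrite FqM ?FqV. Qed.

Definition Tr (x : F) : F := x + x ^+ q.

Lemma TrD (x y : F) : Tr (x + y) = Tr x + Tr y.
Proof. by rewrite /Tr frobD; ring. Qed.
Lemma TrN (x : F) : Tr (- x) = - Tr x.
Proof. by rewrite /Tr frobN; ring. Qed.
Lemma TrB (x y : F) : Tr (x - y) = Tr x - Tr y.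
Proof. by rewrite TrD TrN. Qed.
Lemma TrZ (t x : F) : t \in Fq -> Tr (t * x) = t * Tr x.
Proof. by move=> /FqP ht; rewrite /Tr exprMn ht mulrDr. Qed.
Lemma Tr_Fq (x : F) : Tr x \in Fq.
Proof. by apply/FqP; rewrite /Tr frobD frobK addrC. Qed.

Lemma card_Tr_fiber (y : F) : (#|[set x : F | Tr x == y]| <= q)%N.
Proof.
have q1 : (1 < q)%N by rewrite (leq_trans _ q_ge3).
pose P : {poly F} := 'X^q + ('X - y%:P).
have szP : size P = q.+1.
  by rewrite size_polyDl ?size_polyXn // size_XsubC ltnS.
rewrite -ltnS -szP; apply: card_roots_le; first by rewrite -size_poly_eq0 szP.
move=> x; rewrite inE /root /P hornerD hornerXn hornerXsubC => /eqP <-.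
by apply/eqP; rewrite /Tr; ring.
Qed.

(** Trace fibres have at most q elements, so the image of the trace, which lies in [Fq], has at
    least q; the polynomial X^q - X gives the other bound. *)
Lemma card_Fq : #|Fq| = q.
Proof.
have q1 : (1 < q)%N by rewrite (leq_trans _ q_ge3).
apply/eqP; rewrite eqn_leq; apply/andP; split.
  pose P : {poly F} := 'X^q - 'X.
  have szP : size P = q.+1 by rewrite size_polyDl ?size_polyXn // size_polyN size_polyX ltnS.
  rewrite -ltnS -szP; apply: card_roots_le; first by rewrite -size_poly_eq0 szP.
  by move=> x; rewrite inE /root /P !hornerE subr_eq0.
rewrite -(leq_pmul2l q_gt0) mulnn -hF -cardsT.
apply: (card_le_fibers (f := Tr)) => [x _|y _]; first exact: Tr_Fq.
apply: leq_trans (card_Tr_fiber y).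
by apply/subset_leq_card/subsetP => x; rewrite !inE.
Qed.

Lemma NmM (x y : F) : Nm q (x * y) = Nm q x * Nm q y.
Proof. by rewrite /Nm exprMn. Qed.
Lemma Nm_eq0 (x : F) : (Nm q x == 0) = (x == 0).
Proof. by rewrite /Nm expf_eq0. Qed.
Lemma Nm_Fq (x : F) : Nm q x \in Fq.
Proof. by apply/FqP; rewrite /Nm exprS exprMn frobK mulrC. Qed.

Lemma Nm_nmul (x y : F) : Nm q (x ⋆ y) = Nm q x * Nm q y.
Proof.
rewrite nmulE NmM; case: ifP => // _; congr (_ * _).
by rewrite -[RHS](FqP _ (Nm_Fq x)) /Nm -!exprM mulnC.
Qed.

(** Norm fibres have at most q + 1 elements, so the q^2 - 1 nonzero arguments need at least q - 1
    values. *)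
Lemma Nm_onto (t : F) : t \in Fq -> t != 0 -> exists2 c : F, c != 0 & Nm q c = t.
Proof.
move=> tq t0; have tin : t \in Fq :\ 0 by rewrite in_setD1 t0 tq.
suff imE : [set Nm q x | x in [set~ (0 : F)]] = Fq :\ 0.
  by move: tin; rewrite -imE => /imsetP[c]; rewrite in_setC1 => c0 ->; exists c.
apply: eq_of_subset_leq_card.
  apply/subsetP => y /imsetP[x]; rewrite in_setC1 => x0 ->.
  by rewrite in_setD1 Nm_eq0 x0 Nm_Fq.
rewrite -(leq_pmul2l (ltn0Sn q)).
have -> : (q.+1 * #|(Fq :\ 0)%R|)%N = #|[set~ (0 : F)]|.
  have := cardsD1 (0 : F)%R Fq; rewrite Fq0 card_Fq card_nz add1n => hh.
  by move: hh; set m := #|_| => hh; rewrite {2}hh -mulnn; lia.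
apply: (card_le_fibers (f := @Nm q F)) => [x xn|y _]; first by apply/imsetP; exists x.
apply: leq_trans (card_exp_le y (ltn0Sn q)).
by apply/subset_leq_card/subsetP => x; rewrite !inE => /andP[].
Qed.

(** * Ovals and ovoids *)

Lemma prod_Fq_shift (a : F) : a \in Fq ->
  \prod_(x in Fq :\ a) (x - a) = \prod_(x in Fq :\ 0) x.
Proof.
move=> aq; have imE : [set x - a | x in Fq :\ a] = Fq :\ 0.
  apply: eq_of_subset_leq_card.
    apply/subsetP => y /imsetP[x]; rewrite in_setD1 => /andP[xa xq] ->.
    by rewrite in_setD1 subr_eq0 xa FqB.
  rewrite card_imset; last exact: addIr.
  by rewrite !card_setD1 ?Fq0.
by rewrite -imE big_imset //= => x y _ _; apply: addIr.
Qed.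

(* Segre's lemma of tangents, for triangles with one vertex at infinity: with
   [m s] the unique slope through [(s, g s)] missing all other points, it
   gives [m s + m t = 2 * slope s t]; hence [m] is affine and [g] quadratic. *)
Lemma Segre_graph (g : F -> F) :
  (forall t, t \in Fq -> g t \in Fq) ->
  (forall s t u, s \in Fq -> t \in Fq -> u \in Fq ->
     s != t -> s != u -> t != u ->
     (g t - g s) * (u - s) != (g u - g s) * (t - s)) ->
  exists a b c, forall t, t \in Fq -> g t = a * t ^+ 2 + b * t + c.
Proof.
move=> gq no3; pose slope s t := (g t - g s) / (t - s).
have slq s t : s \in Fq -> t \in Fq -> slope s t \in Fq.
  by move=> sq tq; rewrite Fq_div ?FqB ?gq.
have slC s t : slope t s = slope s t by rewrite /slope -(opprB (g t)) -(opprB t) divrNN.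
have sl_inj s t u : s \in Fq -> t \in Fq :\ s -> u \in Fq :\ s ->
    slope s t = slope s u -> t = u.
  rewrite !in_setD1 => sq /andP[ts tq] /andP[us uq] esl.
  apply/eqP/negPn/negP => tu.
  have := no3 s t u sq tq uq; rewrite 2!(eq_sym s) => /(_ ts us tu)/negP; apply.
  by move/eqP: esl; rewrite /slope eqr_div ?subr_eq0.
pose m s := odflt 0 [pick x in Fq :\: [set slope s t | t in Fq :\ s]].
have mP s : s \in Fq -> m s \in Fq /\ forall t, t \in Fq :\ s -> slope s t != m s.
  move=> sq; rewrite /m; case: pickP => [x|none] /=.
    rewrite in_setD => /andP[xn xq]; split=> // t tq.
    by apply: contraNneq xn => <-; apply: imset_f.
  have : Fq \subset [set slope s t | t in Fq :\ s].
    apply/subsetP => x xq; move: (none x); rewrite in_setD xq andbT.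
    by move/negbFE.
  move=> /subset_leq_card /leq_trans /(_ (leq_imset_card _ _)).
  by rewrite (cardsD1 s Fq) sq add1n ltnn.
(* Completing the chord slopes by the tangent slope gives a permutation of [Fq], so that products
   over slopes become the product [C] of all nonzero elements. *)
pose phi s t := if t == s then m s else slope s t.
have phi_inj s : s \in Fq -> {in Fq &, injective (phi s)}.
  move=> sq t u tq uq; have [_ ms] := mP s sq; rewrite /phi.
  case: eqVneq => [->|ts]; case: eqVneq => [->|us] //.
  - by move=> esl; have := ms u; rewrite in_setD1 us uq -esl eqxx => /(_ isT).
  - by move=> esl; have := ms t; rewrite in_setD1 ts tq esl eqxx => /(_ isT).
  - by apply: sl_inj; rewrite // in_setD1 ?ts ?us.
have phi_im s : s \in Fq -> phi s @: Fq = Fq.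
  move=> sq; apply: eq_of_subset_leq_card; last by rewrite card_in_imset //; apply: phi_inj.
  apply/subsetP => y /imsetP[x xq ->]; rewrite /phi.
  by case: ifP => _; rewrite ?slq //; case: (mP s sq).
set C := \prod_(x in Fq :\ 0) x.
have C0 : C != 0 by apply: prod_nz; rewrite in_setD1 eqxx.
have prod_slopes s t : s \in Fq -> t \in Fq -> s != t ->
    (m s - slope s t) * \prod_(u in Fq :\ t :\ s) (slope s u - slope s t) = C.
  move=> sq tq st; rewrite /C -(prod_Fq_shift (slq s t sq tq)).
  have -> : Fq :\ slope s t = phi s @: (Fq :\ t).
    apply/eqP; rewrite eq_sym eqEcard; apply/andP; split.
      apply/subsetP => y /imsetP[x]; rewrite in_setD1 => /andP[xt xq] ->.
      have ->: (phi s x \in Fq :\ slope s t) = (phi s x != slope s t).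
        by rewrite in_setD1 -{1}(phi_im s sq) imset_f ?andbT.
      have <- : phi s t = slope s t by rewrite /phi eq_sym (negPf st).
      by apply: contra_neq xt; apply: phi_inj.
    rewrite card_in_imset => [|x y]; last first.
      by rewrite !in_setD1 => /andP[_ xq] /andP[_ yq]; apply: phi_inj.
    by rewrite !card_setD1 ?slq.
  rewrite big_imset => [/=|x y]; last first.
    by rewrite !in_setD1 => /andP[_ xq] /andP[_ yq]; apply: phi_inj.
  rewrite [RHS](big_setD1 s) ?in_setD1 ?st //=; congr (_ * _).
    by rewrite /phi eqxx.
  apply: eq_bigr => u; rewrite in_setD1 => /andP[us _].
  by rewrite /phi (negPf us).
have prod_diff s t : s \in Fq -> t \in Fq -> s != t ->
    (s - t) * \prod_(u in Fq :\ t :\ s) (u - t) = C.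
  move=> sq tq st; rewrite /C -(prod_Fq_shift tq) [RHS](big_setD1 s) //=.
  by rewrite in_setD1 st.
have two s t : s \in Fq -> t \in Fq -> (m s + m t) * (s - t) = 2 * (g s - g t).
  move=> sq tq; have [->|st] := eqVneq s t; first by rewrite !subrr !mulr0.
  have ts : t != s by rewrite eq_sym.
  have D : Fq :\ s :\ t = Fq :\ t :\ s by apply/setP => x; rewrite !in_setD1 andbCA.
  have E1 := prod_slopes s t sq tq st.
  have E2 := prod_slopes t s tq sq ts.
  have E3 := prod_diff s t sq tq st.
  have E4 := prod_diff t s tq sq ts.
  rewrite D slC in E2; rewrite D in E4.
  (* For each [u] both sides express how far the point over [u] lies above the chord from [s] to
     [t], measured from either end. *)
  have E5 : \prod_(u in Fq :\ t :\ s) (slope s u - slope s t) *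
            \prod_(u in Fq :\ t :\ s) (u - s) =
            \prod_(u in Fq :\ t :\ s) (slope t u - slope s t) *
            \prod_(u in Fq :\ t :\ s) (u - t).
    rewrite -!big_split /=; apply: eq_bigr => u; rewrite !in_setD1.
    move=> /and3P[us ut _]; rewrite /slope.
    by field; rewrite !subr_eq0 us ut ts.
  move: E1 E2 E3 E4 E5; set X := \prod_(u in _) (slope s u - _).
  set Y := \prod_(u in _) (slope t u - _).
  set P := \prod_(u in _) (u - s); set Q := \prod_(u in _) (u - t).
  move=> E1 E2 E3 E4 E5.
  have Q0 : Q != 0 by apply: contraNneq C0 => Q0; rewrite -E3 Q0 mulr0.
  have X0 : X != 0 by apply: contraNneq C0 => X0; rewrite -E1 X0 mulr0.
  (* This sign places [m s] and [m t] symmetrically about the chord slope. *)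
  have PQ : P = - Q.
    apply: (@mulfI _ (t - s)); first by rewrite subr_eq0.
    by rewrite E4 -E3; ring.
  have YX : Y = - X by apply: (mulIf Q0); rewrite -E5 PQ; ring.
  have : m s - slope s t = - (m t - slope s t).
    by apply: (mulIf X0); rewrite E1 -E2 YX; ring.
  have sE : slope s t * (s - t) = g s - g t.
    by rewrite /slope; field; rewrite subr_eq0 ts.
  by move=> E; rewrite -sE mulrA; congr (_ * _); rewrite -[m s](subrK (slope s t)) E; ring.
have m_affine t : t \in Fq -> m t = m 0 + t * (m 1 - m 0).
  move=> tq; have E1 := two t 0 tq Fq0; have E2 := two 0 1 Fq0 Fq1.
  have E3 := two 1 t Fq1 tq; apply/eqP; rewrite -subr_eq0; apply/eqP.
  transitivity ((m t + m 0) * (t - 0) + (m 0 + m 1) * (0 - 1) + (m 1 + m t) * (1 - t)).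
    by ring.
  by rewrite E1 E2 E3; ring.
exists ((m 1 - m 0) / 2), (m 0), (g 0) => t tq.
have := two t 0 tq Fq0; rewrite m_affine // => E.
have -> : g t = g 0 + 2 * (g t - g 0) / 2 by field; exact: two_neq0.
by rewrite -E; field; exact: two_neq0.
Qed.

(* The graph of f, completed by the vertical point at infinity, meets every plane
   of PG(3, q) in 1 or q + 1 points, i.e. it is an ovoid. *)
Definition ovoidal (f : F -> F) :=
  (forall x, f x \in Fq) /\
  forall k b, b \in Fq ->
    #|[set x | f x == Tr (k * x) + b]| = 1%N \/ #|[set x | f x == Tr (k * x) + b]| = q.+1.

(** If both traces vanish at some [d] other than 0, then x^q / x and y^q / y agree and [y / x] lies
    in [Fq]. So the map from [k] to the two traces is injective, and both sides have q^2
    elements. *)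
Lemma Tr_pair_onto (x y a b : F) : x != 0 -> y / x \notin Fq ->
  a \in Fq -> b \in Fq -> exists2 k, Tr (k * x) = a & Tr (k * y) = b.
Proof.
move=> x0 yx aq bq; pose T k := (Tr (k * x), Tr (k * y)).
have T_inj : injective T.
  move=> k l [/eqP e1 /eqP e2]; apply/eqP; rewrite -subr_eq0.
  apply: contraNT yx => kl; apply/FqP.
  move: e1 e2; rewrite -![Tr _ == _]subr_eq0 -!TrB -!mulrBl.
  set d := k - l in kl *; rewrite /Tr !exprMn !addr_eq0 => /eqP e1 /eqP e2.
  have dq0 : d ^+ q != 0 by rewrite frob_eq0.
  have xE : x ^+ q = - (d * x) / d ^+ q by rewrite e1; field.
  have yE : y ^+ q = - (d * y) / d ^+ q by rewrite e2; field.
  by rewrite exprVn xE yE; field; rewrite x0 dq0 oppr_eq0 mulf_neq0.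
have : [set T k | k in [set: F]] = setX Fq Fq.
  apply: eq_of_subset_leq_card.
    by apply/subsetP => z /imsetP[k _ ->]; rewrite in_setX !Tr_Fq.
  by rewrite cardsX card_Fq card_imset // cardsT hF mulnn.
move/setP/(_ (a, b)); rewrite in_setX aq bq => /imsetP[k _ [-> ->]].
by exists k.
Qed.

(* Each of the q nonvertical planes through a line with n >= 2 points of the
   ovoid carries q + 1 - n further points, and they cover the remaining ones. *)
Lemma ovoidal_no3 (f : F -> F) (x h s t u : F) : ovoidal f -> h != 0 ->
  s \in Fq -> t \in Fq -> u \in Fq -> s != t -> s != u -> t != u ->
  (f (x + t * h) - f (x + s * h)) * (u - s) !=
  (f (x + u * h) - f (x + s * h)) * (t - s).
Proof.
move=> [fq ov] h0 sq tq uq st su tu; apply/eqP => col.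
have ts0 : t - s != 0 by rewrite subr_eq0 eq_sym.
pose a := (f (x + t * h) - f (x + s * h)) / (t - s).
have aq : a \in Fq by rewrite Fq_div ?FqB.
have ft : f (x + t * h) = f (x + s * h) + (t - s) * a by rewrite /a; field.
have fu : f (x + u * h) = f (x + s * h) + (u - s) * a.
  have -> : (u - s) * a = ((f (x + t * h) - f (x + s * h)) * (u - s)) / (t - s).
    by rewrite /a; field.
  by rewrite col; field.
(* [K] indexes the nonvertical planes through the line of the three points, whose slope in direction
   [h] is [a]. *)
pose x1 := x + s * h; pose K := [set k | Tr (k * h) == a].
have cK : (#|K| <= q)%N.
  rewrite -(card_imset (mem K) (mulIf h0)).
  apply: leq_trans (card_Tr_fiber a); apply/subset_leq_card/subsetP => y.
  by case/imsetP => k; rewrite !inE => /eqP <- ->.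
pose L := [set x1 + r * h | r in Fq].
have cL : #|L| = q.
  rewrite card_in_imset ?card_Fq // => r r' _ _ /addrI; exact: mulIf.
pose Z k := [set y | f y == Tr (k * y) + (f x1 - Tr (k * x1))].
have ZL k r : k \in K -> r \in Fq -> f (x + r * h) = f x1 + (r - s) * a ->
    x + r * h \in Z k :&: L.
  rewrite inE => /eqP ka rq fr; apply/setIP; split; last first.
    by apply/imsetP; exists (r - s); rewrite ?FqB // /x1; ring.
  rewrite inE fr; have -> : x + r * h = x1 + (r - s) * h by rewrite /x1; ring.
  by rewrite mulrDr TrD [k * (_ * h)]mulrCA [Tr (_ * (k * h))]TrZ ?FqB // ka; apply/eqP; ring.
have cZ k : k \in K -> (#|Z k :\: L| <= q - 2)%N.
  move=> kK.
  have sub3 : [set x + s * h; x + t * h; x + u * h] \subset Z k :&: L.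
    apply/subsetP => y; rewrite -setUA => /setUP[|/setUP[]] /set1P ->; apply: ZL => //.
    by rewrite subrr mul0r addr0.
  have c3 : #|[set x + s * h; x + t * h; x + u * h]| = 3.
    rewrite -setUA cardsU1 cards2 !inE.
    by rewrite !(inj_eq (addrI _)) !(inj_eq (mulIf h0)) (negPf st) (negPf su) tu.
  have c3i := subset_leq_card sub3; rewrite c3 in c3i.
  have cZk : (#|Z k| <= q.+1)%N.
    have [|e1|e1] := ov k (f x1 - Tr (k * x1)); first by rewrite FqB ?Tr_Fq.
      by rewrite e1.
    by rewrite e1.
  rewrite leq_subRL ?(ltnW q_ge3) // -ltnS.
  by apply: leq_trans _ cZk; rewrite -(cardsID L (Z k)) -addSn leq_add2r.
(* Every other point of the graph spans such a plane with the line. At most q planes with at most q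
   - 2 further points each would have to hold q^2 - q points. *)
have cover : ~: L \subset \bigcup_(k in K) (Z k :\: L).
  apply/subsetP => y; rewrite inE => yL.
  have yx : (y - x1) / h \notin Fq.
    apply: contra yL => yx; apply/imsetP; exists ((y - x1) / h) => //.
    by rewrite divfK // addrC subrK.
  have [k ka kb] := Tr_pair_onto h0 yx aq (FqB (fq y) (fq x1)).
  apply/bigcupP; exists k; first by rewrite inE ka.
  rewrite in_setD yL inE /=; apply/eqP; move: kb.
  by rewrite mulrBr TrB => kb; rewrite addrCA kb addrC subrK.
have leU : (#|\bigcup_(k in K) (Z k :\: L)| <= \sum_(k in K) #|Z k :\: L|)%N.
  elim/big_rec2: _ => [|k n A _ le]; first by rewrite cards0.
  by rewrite (leq_trans (leq_card_setU _ _)) // leq_add2l.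
have leS : (\sum_(k in K) #|Z k :\: L| <= q * (q - 2))%N.
  apply: (@leq_trans (\sum_(k in K) (q - 2))%N); first exact: leq_sum.
  by rewrite sum_nat_const leq_mul2r cK orbT.
have := leq_trans (subset_leq_card cover) (leq_trans leU leS).
have := cardsC L; rewrite cL hF; set n := #|_| => cLC le_n.
have : (q * q <= q + q * (q - 2))%N by rewrite mulnn -cLC leq_add2l.
rewrite -mulnS leq_pmul2l ?q_gt0 //.
by case: (q) q_ge3 => [|[|r]] //= _; rewrite subn2 /= ltnn.
Qed.

Lemma ovoidal_quadratic (f : F -> F) (x h : F) : ovoidal f ->
  exists a b, forall t, t \in Fq -> f (x + t * h) = a * t ^+ 2 + b * t + f x.
Proof.
move=> ovf; have [->|h0] := eqVneq h 0.
  by exists 0, 0 => t _; rewrite mulr0 !mul0r !addr0 !add0r.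
have [a [b [c fE]]] := @Segre_graph (fun t => f (x + t * h))
  (fun t _ => ovf.1 _)
  (fun s t u => @ovoidal_no3 f x h s t u ovf h0).
exists a, b => t tq; rewrite fE //.
by have := fE 0 Fq0; rewrite mul0r addr0 expr0n /= !mulr0 !add0r => ->.
Qed.

(** The points of an odd function over -1, 0 and 1 are collinear. This will exclude the multiplier
    -1 for the map x -> - x. *)
Lemma ovoidal_not_odd (f : F -> F) : ovoidal f ->
  ~ (forall x, f (- x) = - f x).
Proof.
move=> ovf fN; have n1 : (1 : F) != -1 by rewrite eq_sym one_neqN1.
have := @ovoidal_no3 f 0 1 0 1 (-1) ovf (oner_neq0 _) Fq0 Fq1 (FqN Fq1).
rewrite eq_sym oner_eq0 eq_sym oppr_eq0 oner_eq0 n1 => /(_ isT isT isT).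
rewrite !add0r !mulr1 fN => /eqP; apply.
have f0 : f 0 = 0.
  have := fN 0; rewrite oppr0 => /eqP; rewrite eq_sym -subr_eq0 -opprD oppr_eq0.
  by rewrite -mulr2n -mulr_natl mulf_eq0 (negPf two_neq0) => /eqP.
by rewrite f0; ring.
Qed.

(** By homogeneity f(x + t y) = t^2 f(y + x / t), and multiplying out makes both sides quadratic in
    [t], so their coefficients can be compared. *)
Lemma even_ovoidal_line (f : F -> F) : ovoidal f ->
  (forall x, f (- x) = f x) -> f 0 = 0 -> (3 < q)%N ->
  (forall t x, t \in Fq -> f (t * x) = t ^+ 2 * f x) /\
  forall x y, exists b, forall t, t \in Fq ->
    f (x + t * y) = f x + t * b + t ^+ 2 * f y.
Proof.
move=> ovf f_even f0 q3.
have homog t x : t \in Fq -> f (t * x) = t ^+ 2 * f x.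
  have [a [b fE]] := ovoidal_quadratic 0 x ovf; move: fE; rewrite f0 => fE tq.
  have e1 := fE 1 Fq1; have e2 := fE (-1) (FqN Fq1); have := fE t tq.
  rewrite !add0r ?mul1r ?mulN1r in e1 e2 *; rewrite f_even in e2 => ->.
  have b0 : b = 0.
    apply/eqP; rewrite -(mulrI_eq0 _ (mulfI two_neq0)); apply/eqP.
    transitivity (f x - f x); last exact: subrr.
    by rewrite {1}e1 e2; ring.
  by rewrite e1 b0; ring.
split=> // x y; have [a [b fE]] := ovoidal_quadratic x y ovf.
have [a' [b' fE']] := ovoidal_quadratic y x ovf.
have key t : t \in Fq -> t != 0 ->
    a * t ^+ 2 + b * t + f x = t ^+ 2 * f y + b' * t + a'.
  move=> tq t0; rewrite -fE //.
  have -> : x + t * y = t * (y + t^-1 * x) by field.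
  by rewrite homog // fE' ?FqV //; field.
have k1 := key 1 Fq1 (oner_neq0 _).
have k2 := key (-1) (FqN Fq1); rewrite oppr_eq0 oner_eq0 in k2.
have {}k2 := k2 isT.
have bb : b = b'.
  apply: (mulfI two_neq0); apply/eqP; rewrite -subr_eq0; apply/eqP.
  transitivity ((a * 1 ^+ 2 + b * 1 + f x) - (a * (-1) ^+ 2 + b * (-1) + f x) -
    ((1 ^+ 2 * f y + b' * 1 + a') - ((-1) ^+ 2 * f y + b' * (-1) + a'))); first by ring.
  by rewrite k1 k2 subrr.
(* The arguments 1 and -1 match the linear coefficients but not the outer ones, since [t ^+ 2] is 1
   at both. A fourth element exists because q > 3. *)
pose S := [set 0; 1; -1 : F].
have [t tq] : exists2 t, t \in Fq & t \notin S.
  apply/subsetPn; apply/negP => /subset_leq_card; rewrite card_Fq => le3.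
  have : (#|S| <= 3)%N.
    by rewrite /S -setUA cardsU1 cards2; case: (_ \notin _); case: (_ != _).
  by move=> /(leq_trans le3); rewrite leqNgt q3.
rewrite !inE !negb_or => /andP[/andP[t0 t1] tN1].
have kt := key t tq t0.
have ay : a = f y.
  have t2 : 1 - t ^+ 2 != 0.
    by rewrite subr_eq0 eq_sym sqrf_eq1 negb_or t1.
  apply/eqP; rewrite eq_sym -subr_eq0 -(mulIr_eq0 _ (mulIf t2)); apply/eqP.
  transitivity ((a * t ^+ 2 + b * t + f x) - (a * 1 ^+ 2 + b * 1 + f x) -
    ((t ^+ 2 * f y + b * t + a') - (1 ^+ 2 * f y + b * 1 + a'))); first by ring.
  by rewrite kt k1 -bb subrr.
by exists b => s sq; rewrite fE // ay; ring.
Qed.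

Lemma Fq_basis (c x : F) : c \notin Fq ->
  exists s t, [/\ s \in Fq, t \in Fq & x = s + t * c].
Proof.
move=> cq; have d0 : c - c ^+ q != 0.
  by rewrite subr_eq0 eq_sym; apply: contra cq => /eqP/FqP.
have d0' : c ^+ q - c != 0 by rewrite -opprB oppr_eq0.
pose t := (x - x ^+ q) / (c - c ^+ q); pose s := x - t * c.
have tq : t \in Fq.
  apply/FqP; rewrite /t exprMn exprVn !frobB !frobK -!(opprB _ (_ ^+ q)).
  by rewrite divrNN.
exists s, t; split=> //; last by rewrite /s subrK.
by apply/FqP; rewrite /s frobB exprMn (FqP _ tq) /t; field.
Qed.

(** On the basis 1, [c] invariance makes the outer coefficients of the form equal, and comparing [f]
    at 1 + c and (1 + c) c gives the middle one as Tr(c) times them. For [c] of norm 1 this is the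
    norm form. *)
Lemma ovoidal_norm (f : F -> F) (c : F) : ovoidal f ->
  (forall x, f (- x) = f x) -> f 0 = 0 -> (3 < q)%N ->
  c \notin Fq -> Nm q c = 1 -> (forall x, f (x * c) = f x) ->
  forall x, f x = f 1 * Nm q x.
Proof.
move=> ovf f_even f0 q3 cq Nc fc.
have [homog lin] := even_ovoidal_line ovf f_even f0 q3.
have [B BE] := lin 1 c.
have fc1 : f c = f 1 by rewrite -[in LHS](mul1r c) fc.
have fE s t : s \in Fq -> t \in Fq ->
    f (s + t * c) = s ^+ 2 * f 1 + s * t * B + t ^+ 2 * f 1.
  move=> sq tq; have [->|s0] := eqVneq s 0.
    by rewrite add0r homog // fc1; ring.
  have -> : s + t * c = s * (1 + t / s * c) by field.
  by rewrite homog // BE ?Fq_div // fc1; field.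
pose T := Tr c; have Tq : T \in Fq by apply: Tr_Fq.
have Ncc : c * c ^+ q = 1 by rewrite -exprS.
have cc : c * c = -1 + T * c by rewrite -Ncc /T /Tr; ring.
(* With norm 1, a trace of -2 would make [c] the double root -1, which lies in [Fq]. *)
have T2 : 2 + T != 0.
  apply: contra cq => /eqP T2; have : (c + 1) ^+ 2 = (2 + T) * c.
    by rewrite expr2 mulrDl !mulrDr cc; ring.
  rewrite T2 mul0r => /eqP; rewrite sqrf_eq0 addr_eq0 => /eqP ->.
  exact: FqN Fq1.
have BT : B = T * f 1.
  apply: (mulfI T2).
  have := fc (1 + 1 * c).
  have -> : (1 + 1 * c) * c = -1 + (1 + T) * c by rewrite mul1r mulrDl cc; ring.
  rewrite (fE _ _ (FqN Fq1) (FqD Fq1 Tq)) (fE _ _ Fq1 Fq1) => /eqP.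
  rewrite -subr_eq0 => /eqP E.
  apply/eqP; rewrite -subr_eq0 -oppr_eq0; apply/eqP; rewrite -[RHS]E.
  by ring.
move=> x; have [s [t [sq tq ->]]] := Fq_basis x cq.
rewrite fE // /Nm (exprS _ q) frobD exprMn (FqP _ sq) (FqP _ tq) BT.
have -> : (s + t * c) * (s + t * c ^+ q) = s ^+ 2 + s * t * T + t ^+ 2 * (c * c ^+ q).
  by rewrite /T /Tr; ring.
by rewrite Ncc; ring.
Qed.

(** * Points, lines and collineations *)

Fact sline_subproof (m b : F) : is_line (- m, 1 : F, - b).
Proof. by rewrite /= eqxx. Qed.

Definition sline (m b : F) : line F := Line (sline_subproof m b).

Fact vline_subproof (a : F) : is_line (1 : F, 0 : F, - a).
Proof. by rewrite /= !eqxx orbT. Qed.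

Definition vline (a : F) : line F := Line (vline_subproof a).

Lemma incident_affine_sline x y m b :
  incident q (affine x y) (sline m b) = (y == x ⋆ m + b).
Proof.
rewrite /incident /= nmul1 n1mul nmulrN addrC addrA [_ + y]addrC.
by rewrite -opprD subr_eq0 addrC.
Qed.

Lemma incident_affine_vline (x y a : F) : incident q (affine x y) (vline a) = (x == a).
Proof. by rewrite /incident /= nmul1 n1mul nmul0 addr0 subr_eq0. Qed.

Lemma incident_affine_inf (x y : F) : incident q (affine x y) (inf_line F) = false.
Proof. by rewrite /incident /= !nmul0 nmul1 !add0r oner_eq0. Qed.

Lemma incident_inf_sline (k m b : F) : incident q (inf_point k) (sline m b) = (k == m).
Proof. by rewrite /incident /= n1mul nmul1 n0mul addr0 addrC subr_eq0. Qed.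

Lemma incident_inf_vline (k a : F) : incident q (inf_point k) (vline a) = false.
Proof. by rewrite /incident /= nmul1 nmul0 n0mul !addr0 oner_eq0. Qed.

Lemma incident_inf_inf (k : F) : incident q (inf_point k) (inf_line F).
Proof. by rewrite /incident /= !nmul0 n0mul !addr0. Qed.

Lemma incident_vert_sline (m b : F) : incident q (inf_vert F) (sline m b) = false.
Proof. by rewrite /incident /= !n0mul nmul1 add0r addr0 oner_eq0. Qed.

Lemma incident_vert_vline (a : F) : incident q (inf_vert F) (vline a).
Proof. by rewrite /incident /= !n0mul nmul0 !addr0. Qed.

Lemma incident_vert_inf : incident q (inf_vert F) (inf_line F).
Proof. by rewrite /incident /= !nmul0 n0mul !addr0. Qed.

Definition incidentE := (incident_affine_sline, incident_affine_vline,
  incident_affine_inf, incident_inf_sline, incident_inf_vline, incident_inf_inf,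
  incident_vert_sline, incident_vert_vline, incident_vert_inf).

Variant point_spec : point F -> Type :=
  | AffinePoint x y : point_spec (affine x y)
  | InfPoint k : point_spec (inf_point k)
  | VertPoint : point_spec (inf_vert F).

Lemma pointP P : point_spec P.
Proof.
case: P => -[[x y] z] Pxyz; have := Pxyz; rewrite /is_point /=.
have [z1 _|_ /=] := eqVneq z 1.
  have -> : Point Pxyz = affine x y by apply: val_inj; rewrite /= z1.
  exact: AffinePoint.
have [z0 /=|//] := eqVneq z 0; have [x1 _|_ /= /andP[/eqP x0 /eqP y1]] := eqVneq x 1.
  have -> : Point Pxyz = inf_point y by apply: val_inj; rewrite /= z0 x1.
  exact: InfPoint.
have -> : Point Pxyz = inf_vert F by apply: val_inj; rewrite /= z0 x0 y1.
exact: VertPoint.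
Qed.

Variant line_spec : line F -> Type :=
  | SlopeLine m b : line_spec (sline m b)
  | VertLine a : line_spec (vline a)
  | InfLine : line_spec (inf_line F).

Lemma lineP L : line_spec L.
Proof.
case: L => -[[s u] t] Lsut; have := Lsut; rewrite /is_line /=.
have [u1 _|_ /=] := eqVneq u 1.
  have -> : Line Lsut = sline (- s) (- t) by apply: val_inj; rewrite /= u1 !opprK.
  exact: SlopeLine.
have [u0 /=|//] := eqVneq u 0; have [s1 _|_ /= /andP[/eqP s0 /eqP t1]] := eqVneq s 1.
  have -> : Line Lsut = vline (- t) by apply: val_inj; rewrite /= u0 s1 opprK.
  exact: VertLine.
have -> : Line Lsut = inf_line F by apply: val_inj; rewrite /= u0 s0 t1.
exact: InfLine.
Qed.

Lemma affine_inj (x y x' y' : F) : affine x y = affine x' y' -> x = x' /\ y = y'.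
Proof. by case. Qed.

Lemma eq_affine (x y x' y' : F) : (affine x y == affine x' y') = (x == x') && (y == y').
Proof. by rewrite -val_eqE /= !xpair_eqE eqxx andbT. Qed.

Lemma affine_neq_inf (x y k : F) : (affine x y == inf_point k) = false.
Proof. by rewrite -val_eqE /= !xpair_eqE oner_eq0 andbF. Qed.

Lemma affine_neq_vert (x y : F) : (affine x y == inf_vert F) = false.
Proof. by rewrite -val_eqE /= !xpair_eqE oner_eq0 andbF. Qed.

Lemma inf_neq_vert (k : F) : (inf_point k == inf_vert F) = false.
Proof. by rewrite -val_eqE /= !xpair_eqE oner_eq0. Qed.

Lemma collineationP (g : {perm point F}) :
  reflect (forall L, exists M, forall P, incident q (g P) M = incident q P L)
          (g \in collineations q F).
Proof.
rewrite inE; apply: (iffP forallP) => gL L; have := gL L.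
  case/existsP => M /eqP gM; exists M => P.
  have /setP/(_ (g P)) := gM; rewrite mem_imset; last exact: perm_inj.
  by rewrite !inE.
case=> M gM; apply/existsP; exists M; apply/eqP/setP => P.
rewrite -[P](permKV g) mem_imset; last exact: perm_inj.
by rewrite !inE gM.
Qed.

Lemma collineationM (g h : {perm point F}) :
  g \in collineations q F -> h \in collineations q F -> (g * h)%g \in collineations q F.
Proof.
move=> /collineationP gL /collineationP hL; apply/collineationP => L.
have [M gM] := gL L; have [N hN] := hL M; exists N => P.
by rewrite permM hN gM.
Qed.

Lemma proj_equiv_trans (U V W : {set point F}) :
  proj_equiv q U V -> proj_equiv q V W -> proj_equiv q U W.
Proof.
move=> [g gc <-] [h hc <-]; exists (g * h)%g; first exact: collineationM.
by rewrite -imset_comp; apply: eq_imset => P; rewrite /= permM.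
Qed.

(** [a] and [b] act on the coordinates and [m] on the slopes; in this generality one construction
    serves the maps phi and the nearfield automorphisms. *)
Definition ext_fun (a b m : F -> F) (P : point F) : point F :=
  let: (x, y, z) := pcoords P in
  if z == 1 then affine (a x) (b y) else if x == 1 then inf_point (m y) else inf_vert F.

Lemma ext_fun_affine a b m x y : ext_fun a b m (affine x y) = affine (a x) (b y).
Proof. by rewrite /ext_fun /= eqxx. Qed.
Lemma ext_fun_inf a b m k : ext_fun a b m (inf_point k) = inf_point (m k).
Proof. by rewrite /ext_fun /= eq_sym oner_eq0 eqxx. Qed.
Lemma ext_fun_vert a b m : ext_fun a b m (inf_vert F) = inf_vert F.
Proof. by rewrite /ext_fun /= eq_sym oner_eq0. Qed.

Definition stdU (A : {set F * F}) : {set point F} :=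
  [set affine z.1 z.2 | z in A] :|: [set inf_vert F].

Section Extension.
Variables a b m : F -> F.
Hypotheses (a_inj : injective a) (b_inj : injective b) (m_inj : injective m).
Let ext_funE := (ext_fun_affine a b m, ext_fun_inf a b m, ext_fun_vert a b m).

Lemma ext_fun_inj : injective (ext_fun a b m).
Proof.
move=> P Q; case: (pointP P) => [x y|k|]; case: (pointP Q) => [x' y'|k'|];
  rewrite !ext_funE // => /eqP;
  rewrite ?eq_affine ?affine_neq_inf ?affine_neq_vert ?inf_neq_vert //;
  try by rewrite eq_sym ?affine_neq_inf ?affine_neq_vert ?inf_neq_vert.
- by case/andP => /eqP/a_inj-> /eqP/b_inj->.
- by move/eqP=> [] /m_inj->.
Qed.

Definition ext : {perm point F} := perm ext_fun_inj.

Lemma ext_collineation :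
  (forall k c, exists c', forall x, b (x ⋆ k + c) = a x ⋆ m k + c') ->
  ext \in collineations q F.
Proof.
move=> slopes; apply/collineationP => L; case: (lineP L) => [k c|x|].
- have [c' kc] := slopes k c; exists (sline (m k) c') => P; rewrite permE.
  case: (pointP P) => [x y|j|]; rewrite ext_funE !incidentE //.
    by rewrite -kc (inj_eq b_inj).
  by rewrite (inj_eq m_inj).
- exists (vline (a x)) => P; rewrite permE.
  by case: (pointP P) => [x' y|j|]; rewrite ext_funE !incidentE // (inj_eq a_inj).
- exists (inf_line F) => P; rewrite permE.
  by case: (pointP P) => [x' y|j|]; rewrite ext_funE !incidentE.
Qed.

Lemma ext_stdU A : ext @: stdU A = stdU [set (a z.1, b z.2) | z in A].
Proof.
rewrite /stdU imsetU imset_set1 permE ext_fun_vert -!imset_comp; congr (_ :|: _).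
by apply: eq_imset => z /=; rewrite permE ext_fun_affine.
Qed.
End Extension.

Lemma in_stdU_affine A x y : (affine x y \in stdU A) = ((x, y) \in A).
Proof.
rewrite in_setU in_set1 affine_neq_vert orbF; apply/imsetP/idP.
  by case=> -[x' y'] zA /affine_inj[-> ->].
by move=> zA; exists (x, y).
Qed.

Lemma in_stdU_inf A k : (inf_point k \in stdU A) = false.
Proof.
rewrite in_setU in_set1 inf_neq_vert orbF; apply/imsetP => -[z _] /eqP.
by rewrite eq_sym affine_neq_inf.
Qed.

Lemma in_stdU_vert A : inf_vert F \in stdU A.
Proof. by rewrite in_setU in_set1 eqxx orbT. Qed.

Definition in_stdU := (in_stdU_affine, in_stdU_inf, in_stdU_vert).

Lemma proj_equiv_ext (a b m : F -> F) (A : {set F * F}) :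
  injective a -> injective b -> injective m ->
  (forall k c, exists c', forall x, b (x ⋆ k + c) = a x ⋆ m k + c') ->
  proj_equiv q (stdU A) (stdU [set (a z.1, b z.2) | z in A]).
Proof.
move=> ai bi mi slopes; exists (ext ai bi mi); first exact: ext_collineation.
exact: ext_stdU.
Qed.

Section Phi.
Variables c d u v : F.
Hypotheses (c0 : c != 0) (d0 : d != 0).

Lemma aff_inj (r s : F) : r != 0 -> injective (fun x => x ⋆ r + s).
Proof. by move=> r0 x y /addIr; apply: nmulIl. Qed.

Lemma phi_slope_inj : injective (fun k => ninv c ⋆ k ⋆ d).
Proof.
by move=> k l /(nmulIl d0); apply: nmulIr; rewrite ninv_eq0.
Qed.

Lemma phi_slopes (k b : F) : exists b', forall x,
  (x ⋆ k + b) ⋆ d + v = (x ⋆ c + u) ⋆ (ninv c ⋆ k ⋆ d) + b'.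
Proof.
exists (b ⋆ d + v - u ⋆ (ninv c ⋆ k ⋆ d)) => x.
rewrite !nmulDl !nmulA nmulKV //; ring.
Qed.

Definition phi : {perm point F} :=
  ext (@aff_inj c u c0) (@aff_inj d v d0) phi_slope_inj.

Lemma phi_collineation : phi \in collineations q F.
Proof. by apply: ext_collineation => k b; exact: phi_slopes. Qed.

Lemma phi_affine x y : phi (affine x y) = affine (x ⋆ c + u) (y ⋆ d + v).
Proof. by rewrite permE ext_fun_affine. Qed.

Lemma proj_equiv_phi A :
  proj_equiv q (stdU A) (stdU [set (z.1 ⋆ c + u, z.2 ⋆ d + v) | z in A]).
Proof.
apply: (proj_equiv_ext A (@aff_inj c u c0) (@aff_inj d v d0) phi_slope_inj) => k b.
exact: phi_slopes.
Qed.
End Phi.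

(** * The exchange of coordinates *)

Lemma ninvK : involutive ninv.
Proof.
move=> x; have [->|x0] := eqVneq x 0.
  by apply/eqP; rewrite !ninv_eq0.
have v0 : ninv x != 0 by rewrite ninv_eq0.
by apply: (nmulIr v0); rewrite /= nmulV // nVmul.
Qed.

(** Exchanging affine coordinates turns slope [k] into [ninv k], while horizontal and vertical lines
    change places. *)
Definition swap_fun (P : point F) : point F :=
  let: (x, y, z) := pcoords P in
  if z == 1 then affine y x
  else if x == 0 then inf_point 0
  else if y == 0 then inf_vert F else inf_point (ninv y).

Lemma swap_affine (x y : F) : swap_fun (affine x y) = affine y x.
Proof. by rewrite /swap_fun /= eqxx. Qed.
Lemma swap_inf (k : F) :
  swap_fun (inf_point k) = if k == 0 then inf_vert F else inf_point (ninv k).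
Proof. by rewrite /swap_fun /= oner_eq0 eq_sym oner_eq0. Qed.
Lemma swap_vert : swap_fun (inf_vert F) = inf_point 0.
Proof. by rewrite /swap_fun /= eqxx eq_sym oner_eq0. Qed.

Lemma swap_funK : involutive swap_fun.
Proof.
move=> P; case: (pointP P) => [x y|k|]; rewrite ?swap_affine ?swap_vert ?swap_inf ?eqxx //.
case: eqVneq => [->|k0]; first by rewrite swap_vert.
by rewrite swap_inf ninv_eq0 (negPf k0) ninvK.
Qed.

Definition swap : {perm point F} := perm (inv_inj swap_funK).

Lemma swapE P : swap P = swap_fun P. Proof. exact: permE. Qed.

Lemma swapV : (swap^-1)%g = swap.
Proof.
apply/permP => P; apply: (@perm_inj _ swap); rewrite permKV.
by rewrite !swapE swap_funK.
Qed.

Lemma swap_collineation : swap \in collineations q F.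
Proof.
apply/collineationP => L; case: (lineP L) => [k b|x|].
- have [k0|k0] := eqVneq k 0.
    exists (vline b) => P; rewrite swapE.
    case: (pointP P) => [x y|j|]; rewrite ?swap_affine ?swap_vert ?swap_inf ?incidentE //.
      by rewrite k0 nmul0 add0r.
    by rewrite k0; case: eqVneq => j0; rewrite incidentE.
  exists (sline (ninv k) (- (b ⋆ ninv k))) => P; rewrite swapE.
  case: (pointP P) => [x y|j|]; rewrite ?swap_affine ?swap_vert ?swap_inf ?incidentE //.
    rewrite -nmulBl -(inj_eq (nmulIl k0)) nmulVK // eq_sym.
    by rewrite subr_eq.
  case: eqVneq => j0; rewrite incidentE; first by rewrite j0 eq_sym (negPf k0).
  by rewrite (inj_eq (inv_inj ninvK)).
  by rewrite eq_sym ninv_eq0 (negPf k0).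
- exists (sline 0 x) => P; rewrite swapE.
  case: (pointP P) => [x' y|j|]; rewrite ?swap_affine ?swap_vert ?swap_inf ?incidentE ?eqxx //.
    by rewrite nmul0 add0r.
  by case: eqVneq => j0; rewrite incidentE // ninv_eq0 (negPf j0).
- exists (inf_line F) => P; rewrite swapE.
  case: (pointP P) => [x' y|j|]; rewrite ?swap_affine ?swap_vert ?swap_inf ?incidentE ?eqxx //.
  by case: eqVneq => j0; rewrite incidentE.
Qed.

(** * Affine parts of unitals and their stabilisers *)

Definition affine_part (U : {set point F}) : {set F * F} :=
  [set z | affine z.1 z.2 \in U].

Lemma stdU_affine_part (U : {set point F}) : inf_vert F \in U -> tangent q U (inf_line F) ->
  U = stdU (affine_part U).
Proof.
move=> Uv /cards1P[P UP]; have Pv : P = inf_vert F.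
  have : inf_vert F \in U :&: points_on q (inf_line F).
    by rewrite in_setI Uv inE incident_vert_inf.
  by rewrite UP inE => /eqP.
apply/setP => Q; case: (pointP Q) => [x y|k|].
- by rewrite in_stdU_affine inE.
- rewrite in_stdU_inf; apply/negbTE/negP => Uk.
  have : inf_point k \in U :&: points_on q (inf_line F).
    by rewrite in_setI Uk inE incident_inf_inf.
  by rewrite UP Pv inE inf_neq_vert.
- by rewrite in_stdU_vert Uv.
Qed.

Definition col (A : {set F * F}) (x : F) : {set F} := [set y | (x, y) \in A].
Definition sec (A : {set F * F}) (m b : F) : {set F} := [set x | (x, x ⋆ m + b) \in A].

Definition affine_unital (A : {set F * F}) :=
  (forall x, #|col A x| = q) /\
  forall m b, #|sec A m b| = 1%N \/ #|sec A m b| = q.+1.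

Lemma card_stdU A : #|stdU A| = #|A|.+1.
Proof.
rewrite /stdU setUC cardsU1 card_imset; last first.
  by move=> [x y] [x' y'] /affine_inj /= [-> ->].
suff -> : inf_vert F \notin [set affine z.1 z.2 | z in A] by rewrite add1n.
by apply/imsetP => -[z _] /eqP; rewrite eq_sym affine_neq_vert.
Qed.

Lemma card_stdU_sline A m b :
  #|stdU A :&: points_on q (sline m b)| = #|sec A m b|.
Proof.
rewrite -(card_imset (mem (sec A m b)) (f := fun x => affine x (x ⋆ m + b))); last first.
  by move=> x x' /affine_inj[].
congr #|pred_of_set _|; apply/setP => P; rewrite in_setI [X in _ && X]inE; apply/andP/imsetP.
  case: (pointP P) => [x y|k|]; rewrite in_stdU ?incidentE; case=> //.
  by move=> xyA /eqP yE; exists x; rewrite ?inE -?yE.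
by case=> x; rewrite inE => xA ->; rewrite in_stdU_affine incidentE.
Qed.

Lemma card_stdU_vline A a :
  #|stdU A :&: points_on q (vline a)| = #|col A a|.+1.
Proof.
have -> : stdU A :&: points_on q (vline a) = inf_vert F |: [set affine a y | y in col A a].
  apply/setP => P; rewrite in_setI in_setU1 [X in _ && X]inE; apply/andP/orP.
    case: (pointP P) => [x y|k|]; rewrite in_stdU ?incidentE; case=> //; last by left.
    by move=> xyA /eqP xa; right; apply/imsetP; exists y; rewrite ?inE -?xa.
  case=> [/eqP->|/imsetP[y]]; first by rewrite in_stdU_vert incidentE.
  by rewrite inE => yA ->; rewrite in_stdU_affine incidentE.
rewrite cardsU1 card_imset; last by move=> y y' /affine_inj[].
suff -> : inf_vert F \notin [set affine a y | y in col A a] by rewrite add1n.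
by apply/imsetP => -[z _] /eqP; rewrite eq_sym affine_neq_vert.
Qed.

Lemma card_cols (A : {set F * F}) : #|A| = (\sum_x #|col A x|)%N.
Proof.
rewrite -sum1_card (partition_big fst predT) //=; apply: eq_bigr => x _.
rewrite sum1dep_card -(card_imset (mem (col A x)) (f := pair x)); last by move=> y y' [].
congr #|pred_of_set _|; apply/setP => -[x' y]; rewrite !inE; apply/andP/imsetP => /=.
  by case=> xA /eqP x'x; exists y; rewrite ?inE -?x'x.
by case=> y'; rewrite inE => xA [-> ->].
Qed.

(** A vertical line already contains [inf_vert F], so each column has 0 or q points. One empty
    column would leave at most (q^2 - 1) q affine points instead of q^3. *)
Lemma unital_stdU A : unital q (stdU A) -> affine_unital A.
Proof.
move=> [cU lU]; split=> [x|m b]; last first.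
  by case: (lU (sline m b)) => /eqP; rewrite card_stdU_sline; [left|right].
have col0q y : (#|col A y| <= q)%N /\ (#|col A y| = 0 \/ #|col A y| = q)%N.
  by case: (lU (vline y)) => /eqP; rewrite card_stdU_vline => -[->]; split=> //; [left|right].
have [_ [cx|//]] := col0q x; exfalso.
have : (#|A| <= #|[set~ x]| * q)%N.
  rewrite card_cols (bigD1 x) //= cx add0n -sum_nat_const.
  have -> : (\sum_(i in [set~ x]) q = \sum_(i | i != x) q)%N.
    by apply: eq_bigl => i; rewrite !inE.
  by apply: leq_sum => y _; case: (col0q y).
move: cU; rewrite card_stdU cardsC1 hF => -[->].
have := q_gt0; rewrite expnSr => q0; rewrite leq_pmul2r //.
by rewrite -ltnS prednK ?ltnn // expn_gt0 q0.
Qed.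

(* The quadruple ((c, u), (d, v)) stands for phi(c, d, u, v), grouped by coordinate. *)
Definition stab (A : {set F * F}) : {set (F * F) * (F * F)} :=
  [set w | [&& w.1.1 != 0, w.2.1 != 0 &
     [forall z in A, (z.1 ⋆ w.1.1 + w.1.2, z.2 ⋆ w.2.1 + w.2.2) \in A]]].

Lemma stabP (A : {set F * F}) (c u d v : F) : reflect
  [/\ c != 0, d != 0 & forall x y, (x, y) \in A -> (x ⋆ c + u, y ⋆ d + v) \in A]
  (((c, u), (d, v)) \in stab A).
Proof.
rewrite inE /=; apply: (iffP and3P) => -[c0 d0 wA]; split=> //.
  by move=> x y; move/forall_inP: wA => wA /wA.
by apply/forall_inP => -[x y]; apply: wA.
Qed.

(** A point at infinity lies on a line whose image is forced by two affine points. Its own image is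
    the infinite point of that line, because all affine points are already images of affine
    points. *)
Lemma collineation_phi (c d u v : F) (g : {perm point F}) (c0 : c != 0) (d0 : d != 0) :
  g \in collineations q F -> acts_as_phi q c d u v g -> g = phi u v c0 d0.
Proof.
move=> /collineationP gL /forallP gA.
have gE x y : g (affine x y) = affine (x ⋆ c + u) (y ⋆ d + v).
  by have /forallP/(_ y)/eqP := gA x.
have g_aff x y : exists x' y', g (affine x' y') = affine x y.
  exists ((x - u) ⋆ ninv c), ((y - v) ⋆ ninv d).
  by rewrite gE !nmulVK // !subrK.
have g_naff P x y : (forall x y, affine x y != P) -> g P != affine x y.
  move=> nP; have [x' [y' <-]] := g_aff x y.
  by rewrite (inj_eq perm_inj) eq_sym nP.
apply/permP => P; case: (pointP P) => [x y|k|]; rewrite [RHS]permE.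
- by rewrite ext_fun_affine gE.
- rewrite ext_fun_inf; have [M gM] := gL (sline k 0).
  have := gM (affine 0 0); have := gM (affine 1 k); have := gM (inf_point k).
  have naff x y : affine x y != inf_point k by rewrite affine_neq_inf.
  rewrite !gE !incidentE !(n0mul, n1mul) !(add0r, addr0) !eqxx.
  case: (lineP M) => [m b|a|]; rewrite ?incidentE //; last first.
    move=> _ /eqP e1 /eqP e2; case/eqP: c0; apply: (addIr u).
    by rewrite e1 add0r e2.
  move=> gP /eqP e1 /eqP e2.
  have cm : c ⋆ m = k ⋆ d.
    apply: (addIr v); rewrite e1 nmulDl -addrA; congr (_ + _).
    exact: esym.
  have -> : ninv c ⋆ k ⋆ d = m by rewrite -nmulA -cm nmulA nVmul // n1mul.
  have ng x y := g_naff (inf_point k) x y naff.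
  case: (pointP (g (inf_point k))) gP ng => [x y|j|];
    rewrite ?incidentE //; last by move/eqP->.
  by move=> _ /(_ x y); rewrite eqxx.
- rewrite ext_fun_vert; have [M gM] := gL (vline 0).
  have := gM (affine 0 0); have := gM (affine 0 1); have := gM (inf_vert F).
  have naff x y : affine x y != inf_vert F by rewrite affine_neq_vert.
  rewrite !gE !incidentE !(n0mul, n1mul) !add0r !eqxx.
  case: (lineP M) => [m b|a|]; rewrite ?incidentE //.
    move=> _ /eqP e1 /eqP e2; case/eqP: d0; apply: (addIr v).
    by rewrite e1 add0r.
  have ng x y := g_naff (inf_vert F) x y naff.
  case: (pointP (g (inf_vert F))) ng => [x y|j|];
    rewrite ?incidentE //.
  by move=> /(_ x y); rewrite eqxx.
Qed.

(** The only infinite point of the set must be fixed, as affine points come from affine points; but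
    a map gamma sends vertical lines to horizontal ones. *)
Lemma acts_as_phi_of_stdU A (g : {perm point F}) :
  g \in Aut_set q (stdU A) :&: linear_collineations q F ->
  exists c d u v, [/\ c != 0, d != 0 & acts_as_phi q c d u v g].
Proof.
rewrite !inE => /andP[/andP[gc /eqP gU] /andP[_ /existsP[c /existsP[d /existsP[u /existsP[v]]]]]].
move=> /and3P[c0 d0 /orP[gphi|/forallP ggam]]; first by exists c, d, u, v.
exfalso; have gE x y : g (affine x y) = affine (y ⋆ c + u) (x ⋆ d + v).
  by have /forallP/(_ y)/eqP := ggam x.
have gv : g (inf_vert F) = inf_vert F.
  have : g (inf_vert F) \in stdU A by rewrite -gU imset_f ?in_stdU_vert.
  move Eg: (g (inf_vert F)) => P; case: (pointP P) Eg => [x y gxy _|k _|//]; last first.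
    by rewrite in_stdU_inf.
  have : g (affine ((y - v) ⋆ ninv d) ((x - u) ⋆ ninv c)) = affine x y.
    by rewrite gE !nmulVK // !subrK.
  rewrite -gxy => /perm_inj/eqP; by rewrite affine_neq_vert.
have /collineationP/(_ (vline 0))[M gM] : g \in collineations q F by rewrite inE.
have := gM (affine 0 0); have := gM (affine 0 1); have := gM (inf_vert F).
rewrite gv !gE !incidentE !(n0mul, n1mul) !add0r !eqxx.
case: (lineP M) => [m b|a|]; rewrite ?incidentE //.
move=> _ /eqP e1 /eqP e2; case/eqP: c0; apply: (addIr u).
by rewrite e1 add0r.
Qed.

Lemma phi_stdU (A : {set F * F}) (c d u v : F) (c0 : c != 0) (d0 : d != 0) :
  (phi u v c0 d0 @: stdU A == stdU A) =
  [forall z in A, (z.1 ⋆ c + u, z.2 ⋆ d + v) \in A].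
Proof.
rewrite /phi ext_stdU; set B := [set _ | z in A].
have cB : #|B| = #|A|.
  rewrite card_imset // => -[x y] [x' y'] /= [].
  by move=> /addIr/(nmulIl c0)-> /addIr/(nmulIl d0)->.
have -> : (stdU B == stdU A) = (B == A).
  apply/eqP/eqP => [/setP BA|->//]; apply/setP => -[x y].
  by have := BA (affine x y); rewrite !in_stdU_affine.
rewrite eqEcard cB leqnn andbT; apply/subsetP/forall_inP => [BA z zA|BA _ /imsetP[z zA ->]].
  by apply: BA; apply/imsetP; exists z.
exact: BA.
Qed.

Lemma acts_phi_phi (c d u v : F) (c0 : c != 0) (d0 : d != 0) :
  acts_as_phi q c d u v (phi u v c0 d0).
Proof. by apply/forallP => x; apply/forallP => y; rewrite phi_affine. Qed.

Lemma acts_as_phi_uniq (c d u v c' d' u' v' : F) (g : {perm point F}) :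
  acts_as_phi q c d u v g -> acts_as_phi q c' d' u' v' g ->
  ((c, u), (d, v)) = ((c', u'), (d', v')).
Proof.
move=> /forallP g1 /forallP g2.
have /forallP/(_ 0)/eqP e1 := g1 0; have /forallP/(_ 0)/eqP e2 := g2 0.
have /forallP/(_ 1)/eqP e3 := g1 1; have /forallP/(_ 1)/eqP e4 := g2 1.
move: e1 e3; rewrite e2 e4 !n0mul !n1mul !add0r => /affine_inj[-> ->].
by move=> /affine_inj[/addIr-> /addIr->].
Qed.

Lemma card_stab A :
  #|Aut_set q (stdU A) :&: linear_collineations q F| = #|stab A|.
Proof.
set G := _ :&: _.
pose acts g (w : (F * F) * (F * F)) :=
  [&& w.1.1 != 0, w.2.1 != 0 & acts_as_phi q w.1.1 w.2.1 w.1.2 w.2.2 g].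
(* The default is never reached on [G], and the parameters are determined by the images of (0, 0)
   and (1, 1). *)
pose wit g := odflt ((0, 0), (0, 0)) [pick w | acts g w].
have witP g : g \in G -> acts g (wit g).
  move=> /acts_as_phi_of_stdU[c [d [u [v [c0 d0 gphi]]]]]; rewrite /wit.
  case: pickP => [//|/(_ ((c, u), (d, v)))]; by rewrite /acts /= c0 d0 gphi.
have Gc g : g \in G -> g \in collineations q F.
  by rewrite /G in_setI => /andP[]; rewrite inE => /andP[].
have wit_inj : {in G &, injective wit}.
  move=> g h gG hG wgh; have := witP g gG; have := witP h hG; rewrite -wgh.
  case: (wit g) => -[c u] [d v] /and3P[/= c0 d0 hw] /and3P[_ _ gw].
  by rewrite (collineation_phi c0 d0 (Gc g gG) gw) (collineation_phi c0 d0 (Gc h hG) hw).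
rewrite -(card_in_imset wit_inj); congr #|pred_of_set _|.
apply/setP => -[[c u] [d v]]; apply/imsetP/idP.
  case=> g gG wE; have := witP g gG; rewrite -wE => /and3P[/= c0 d0 gw].
  have gE := collineation_phi c0 d0 (Gc g gG) gw.
  rewrite inE /= c0 d0 -(phi_stdU A u v c0 d0) -gE.
  by move: gG; rewrite !inE => /andP[/andP[]].
rewrite inE /= => /and3P[c0 d0]; rewrite -(phi_stdU A u v c0 d0) => phiU.
have phiG : phi u v c0 d0 \in G.
  rewrite /G in_setI !(in_set (fun _ => _ && _)) phi_collineation phiU /=.
  apply/existsP; exists c; apply/existsP; exists d; apply/existsP; exists u.
  by apply/existsP; exists v; rewrite c0 d0 acts_phi_phi.
exists (phi u v c0 d0) => //; have := witP _ phiG.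
case: (wit _) => -[c' u'] [d' v'] /and3P[_ _ /= gw].
exact: acts_as_phi_uniq (acts_phi_phi _ _ _ _) gw.
Qed.

(** * Transport of the hypotheses along the exchange *)

Lemma card_swap_line (U : {set point F}) L M :
  (forall P, incident q (swap P) M = incident q P L) ->
  #|(swap @: U) :&: points_on q L| = #|U :&: points_on q M|.
Proof.
move=> sM; rewrite -(card_imset (mem (U :&: points_on q M)) (@perm_inj _ swap)).
congr #|pred_of_set _|; apply/setP => P; rewrite -(permKV swap P).
rewrite in_setI !(mem_imset _ _ (@perm_inj _ swap)) in_setI !inE.
by rewrite -sM !swapE swap_funK.
Qed.

Lemma parabolic_swap (U : {set point F}) :
  parabolic_unital q U -> parabolic_unital q (swap @: U).
Proof.
move=> [[cU lU] tU]; split; last first.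
  rewrite /tangent (@card_swap_line _ _ (inf_line F)) // => P; rewrite swapE.
  case: (pointP P) => [x y|k|]; rewrite ?swap_affine ?swap_inf ?swap_vert ?incidentE //.
  by case: ifP; rewrite incidentE.
split=> [|L]; first by rewrite card_imset //; apply: perm_inj.
have /collineationP/(_ L)[M sM] := swap_collineation.
by rewrite /tangent /secant (card_swap_line _ sM); apply: lU.
Qed.

(** Conjugation turns the parameters (c, d, u, v) into (d, c, v, u) and preserves each of the two
    kinds of maps. *)
Lemma swap_conj_linear (U : {set point F}) (g : {perm point F}) :
  g \in Aut_set q U :&: linear_collineations q F ->
  (g ^ swap)%g \in Aut_set q (swap @: U) :&: linear_collineations q F.
Proof.
rewrite !(in_setI, in_set (fun _ => _ && _)).
move=> /andP[/andP[gc /eqP gU] /andP[_ /existsP[c /existsP[d /existsP[u /existsP[v]]]]]].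
move=> /and3P[c0 d0 gact].
have sc : (g ^ swap)%g \in collineations q F.
  rewrite conjgE swapV; apply: collineationM; first exact: swap_collineation.
  by apply: collineationM => //; apply: swap_collineation.
rewrite sc /=; apply/andP; split.
  rewrite -{2}gU -!imset_comp; apply/eqP/eq_imset => P /=.
  by rewrite conjgE !permM permK.
have sgE x y : (g ^ swap)%g (affine x y) = swap (g (affine y x)).
  by rewrite conjgE !permM swapV [swap (affine _ _)]swapE swap_affine.
apply/existsP; exists d; apply/existsP; exists c; apply/existsP; exists v.
apply/existsP; exists u; rewrite c0 d0 /=.
case/orP: gact => /forallP gact; apply/orP; [left|right];
  apply/forallP => x; apply/forallP => y; have /forallP/(_ x)/eqP e1 := gact y;
  by rewrite sgE e1 swapE swap_affine.
Qed.

Lemma swap_swap (U : {set point F}) : swap @: (swap @: U) = U.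
Proof.
rewrite -imset_comp -[RHS]imset_id; apply: eq_imset => P /=.
by rewrite !swapE swap_funK.
Qed.

Lemma card_linear_swap (U : {set point F}) :
  #|Aut_set q (swap @: U) :&: linear_collineations q F| =
  #|Aut_set q U :&: linear_collineations q F|.
Proof.
suff le (V : {set point F}) : (#|Aut_set q V :&: linear_collineations q F| <=
    #|Aut_set q (swap @: V) :&: linear_collineations q F|)%N.
  by apply/eqP; rewrite eqn_leq le andbT; have := le (swap @: U); rewrite swap_swap.
rewrite -(card_imset (mem (_ :&: _)) (conjg_inj swap)).
apply/subset_leq_card/subsetP => h /imsetP[g gG ->].
exact: swap_conj_linear.
Qed.

(** * The stabiliser of an affine unital *)

Lemma card_additive_dvd (S : {set F}) : 0 \in S ->
  (forall x y, x \in S -> y \in S -> x + y \in S) -> (#|S| %| q ^ 2)%N.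
Proof.
move=> S0 SD; have gS : group_set (S : {set F : finGroupType}).
  by apply/group_setP; split=> // x y; apply: SD.
by rewrite -hF -cardsT; apply: (cardSg (G := [group of setT]) (H := Group gS)); apply: subsetT.
Qed.

Section Stabiliser.
Variable A : {set F * F}.

Lemma stab_id : ((1, 0), (1, 0)) \in stab A.
Proof.
by apply/stabP; rewrite !oner_eq0; split=> // x y; rewrite !nmul1 !addr0.
Qed.

Lemma stab_comp c u d v c' u' d' v' :
  ((c, u), (d, v)) \in stab A -> ((c', u'), (d', v')) \in stab A ->
  ((c ⋆ c', u ⋆ c' + u'), (d ⋆ d', v ⋆ d' + v')) \in stab A.
Proof.
move=> /stabP[c0 d0 g] /stabP[c'0 d'0 g']; apply/stabP; split.
- by rewrite nmul_eq0 negb_or c0.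
- by rewrite nmul_eq0 negb_or d0.
by move=> x y /g/g'; rewrite !nmulDl !nmulA !addrA.
Qed.

Lemma stab_inv c u d v : ((c, u), (d, v)) \in stab A ->
  ((ninv c, - (u ⋆ ninv c)), (ninv d, - (v ⋆ ninv d))) \in stab A.
Proof.
move=> /stabP[c0 d0 g].
have gA : [set (z.1 ⋆ c + u, z.2 ⋆ d + v) | z in A] = A.
  apply: eq_of_subset_leq_card; first by apply/subsetP => z /imsetP[[x y] zA ->]; apply: g.
  rewrite card_imset // => -[x y] [x' y'] /= [].
  by move=> /addIr/(nmulIl c0)-> /addIr/(nmulIl d0)->.
apply/stabP; rewrite !ninv_eq0; split=> // x y; rewrite -{1}gA => /imsetP[[x' y'] zA] [-> ->] /=.
by rewrite !nmulDl !nmulKV // !addrK.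
Qed.

Hypothesis Aun : affine_unital A.

(* A homology with axis [y = y0] and centre [inf_vert F] would act on each
   column semiregularly off [y0]; the order of d being prime to q, [y0] would
   lie in every column, i.e. the axis would be contained in A. *)
Lemma stab_homology d v : ((1, 0), (d, v)) \in stab A -> d = 1.
Proof.
move=> /stabP[_ d0 g]; apply/eqP/negPn/negP => d1.
have dfix x : x ⋆ d = x -> x = 0.
  move=> xd; apply/eqP/negPn/negP => x0; case/negP: d1.
  by apply/eqP/(nmulIr x0); rewrite /= xd nmul1.
have dinj : injective (fun x => x ⋆ d - x).
  move=> x y exy; apply/eqP; rewrite -subr_eq0; apply/eqP/dfix.
  apply/eqP; rewrite nmulBl -subr_eq0; apply/eqP.
  transitivity ((x ⋆ d - x) - (y ⋆ d - y)); first by ring.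
  by rewrite exy subrr.
have [y0 y0E] : exists y0, y0 ⋆ d + v = y0.
  have : [set x ⋆ d - x | x in [set: F]] = setT.
    by apply: eq_of_subset_leq_card; rewrite ?subsetT // card_imset.
  move/setP/(_ (- v)); rewrite inE => /imsetP[y0 _ ey]; exists y0.
  by rewrite -[v]opprK ey; ring.
have y0col x : y0 \in col A x.
  pose B := [set y - y0 | y in col A x].
  have cB : #|B| = q by rewrite card_imset ?(Aun.1 x) //; apply: addIr.
  suff : 0 \in B by case/imsetP => y yA /esym/eqP; rewrite subr_eq0 => /eqP<-.
  apply/negPn/negP => B0.
  have Bd b : b \in B -> b ⋆ d \in B.
    case/imsetP => y; rewrite inE => yA ->; apply/imsetP; exists (y ⋆ d + v).
      by rewrite inE; have := g x y yA; rewrite nmul1 addr0.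
    by rewrite nmulBl -[in RHS]y0E; ring.
  clearbody B; have P0 := prod_nz B0.
  case sd: (is_square d).
    have : d ^+ q = 1.
      rewrite -cB; apply: expr_card_stable => // b /Bd; by rewrite nmulE sd.
    by move/(congr1 (fun z => z ^+ q)); rewrite frobK expr1n => /eqP; rewrite (negPf d1).
  (* A nonsquare [d] turns the product [P] of [B] into [P ^+ q * d ^+ q], which has the opposite
     square class. *)
  have BdE : [set b ⋆ d | b in B] = B.
    apply: eq_of_subset_leq_card; first by apply/subsetP => z /imsetP[b bB ->]; apply: Bd.
    by rewrite (card_imset _ (nmulIl d0)).
  have : (\prod_(b in B) b) ^+ q * d ^+ q = \prod_(b in B) b.
    rewrite -[in RHS]BdE big_imset /=; last by move=> b b' _ _; apply: (nmulIl d0).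
    rewrite [RHS](eq_bigr (fun b => b ^+ q * d)); last by move=> b _; rewrite nmulE sd.
    by rewrite big_split /= prodrXl prodr_const cB.
  set P := \prod_(b in B) b in P0 * => PE.
  have : is_square (P ^+ q * d ^+ q) = is_square P by rewrite PE.
  rewrite is_squareM ?frob_eq0 // !is_square_frob sd.
  by case: (is_square P).
have : sec A 0 y0 = setT.
  by apply/setP => x; have := y0col x; rewrite !inE nmul0 add0r.
have := Aun.2 0 y0 => /[swap] ->; rewrite cardsT hF.
by case=> e1; have := q_lt_sq; rewrite e1 ?ltnn // ltnS ltn0.
Qed.

Definition vtrans : {set F} := [set v | ((1, 0), (1, v)) \in stab A].
Let xparts : {set F * F} := [set w.1 | w in stab A].
Let xtrans : {set F} := [set u | (1, u) \in xparts].

Lemma vtransE v : (v \in vtrans) = (((1, 0), (1, v)) \in stab A).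
Proof. exact: in_set. Qed.

Lemma xtransE u : (u \in xtrans) = ((1, u) \in xparts).
Proof. exact: in_set. Qed.

Lemma xparts_comp c u c' u' : (c, u) \in xparts -> (c', u') \in xparts ->
  (c ⋆ c', u ⋆ c' + u') \in xparts.
Proof.
move=> /imsetP[[[c1 u1] [d v]] gA [-> ->]] /imsetP[[[c2 u2] [d' v']] gA' [-> ->]].
by apply/imsetP; exists ((c1 ⋆ c2, u1 ⋆ c2 + u2), (d ⋆ d', v ⋆ d' + v')); rewrite ?stab_comp.
Qed.

Lemma xparts_inv c u : (c, u) \in xparts -> (ninv c, - (u ⋆ ninv c)) \in xparts.
Proof.
move=> /imsetP[[[c1 u1] [d v]] gA [-> ->]].
by apply/imsetP; eexists; first exact: stab_inv gA.
Qed.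

Lemma xparts_neq0 c u : (c, u) \in xparts -> c != 0.
Proof. by move=> /imsetP[[[c1 u1] [d v]] /stabP[c0 _ _] [-> _]]. Qed.

Lemma vtransD v v' : v \in vtrans -> v' \in vtrans -> v + v' \in vtrans.
Proof.
rewrite !vtransE => gv gv'; have := stab_comp gv gv'.
by rewrite !nmul1 addr0.
Qed.

Lemma vtrans0 : 0 \in vtrans. Proof. by rewrite vtransE stab_id. Qed.

Lemma vtransN v : v \in vtrans -> - v \in vtrans.
Proof.
rewrite !vtransE => /stab_inv.
have -> : ninv 1 = 1 by rewrite -[LHS]n1mul nmulV ?oner_eq0.
by rewrite !nmul1 oppr0.
Qed.

Lemma xtransD u u' : u \in xtrans -> u' \in xtrans -> u + u' \in xtrans.
Proof.
rewrite !xtransE => gu gu'; have := xparts_comp gu gu'.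
by rewrite !nmul1.
Qed.

Lemma xtrans0 : 0 \in xtrans.
Proof. by rewrite xtransE; apply/imsetP; exists ((1, 0), (1, 0)); rewrite ?stab_id. Qed.

(** Two elements with the same action on [x] differ by one that fixes every vertical line, and
    [stab_homology] makes that one a vertical translation. *)
Lemma card_stab_fibers : #|stab A| = (#|vtrans| * #|xparts|)%N.
Proof.
apply: card_uniform_fibers => -[[c u] [d v0]] gA.
rewrite -(card_imset (mem vtrans) (f := fun v => ((c, u), (d, v0 + v)))); last first.
  by move=> v v' [] /addrI.
have [c0 d0 _] := stabP _ _ _ _ _ gA.
congr #|pred_of_set _|; apply/setP => -[[c' u'] [d' v']]; rewrite in_set /=.
apply/andP/imsetP => [[gA' /eqP[ec eu]]|[v]]; last first.
  rewrite vtransE => gv [-> -> -> ->]; rewrite eqxx; split=> //.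
  by have := stab_comp gA gv; rewrite !nmul1 addr0.
rewrite ec eu in gA' *; have := stab_comp (stab_inv gA) gA'.
rewrite nVmul // nmulNl nmulVK // addNr => gg; have dd := stab_homology gg.
have ed : d' = d.
  by apply: (@nmulIr (ninv d)); rewrite /= ?ninv_eq0 // dd nVmul.
rewrite ed in gg *; move: gg; rewrite nVmul // nmulNl nmulVK // => gg.
by exists (- v0 + v'); rewrite ?vtransE // addNKr.
Qed.

Lemma card_xparts_fibers : #|xparts| = (#|xtrans| * #|[set x.1 | x in xparts]|)%N.
Proof.
apply: card_uniform_fibers => -[c u] gA.
rewrite -(card_imset (mem xtrans) (f := fun t => (c, u + t))); last first.
  by move=> v v' [] /addrI.
have c0 := xparts_neq0 gA.
congr #|pred_of_set _|; apply/setP => -[c' u']; rewrite in_set /=.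
apply/andP/imsetP => [[gA' /eqP ec]|[t]]; last first.
  rewrite xtransE => gt [-> ->]; rewrite eqxx; split=> //.
  by have := xparts_comp gA gt; rewrite !nmul1.
rewrite ec in gA' *; have := xparts_comp (xparts_inv gA) gA'.
rewrite nVmul // nmulNl nmulVK // => gg.
by exists (- u + u'); rewrite ?xtransE // addNKr.
Qed.

Hypothesis card_A : #|stab A| = (q * (q ^ 2 - 1))%N.

(** The two translation groups have orders dividing q^2, hence prime to q^2 - 1, so the product of
    these orders divides q. As there are at most q^2 - 1 linear parts, both bounds are attained. *)
Lemma card_trans :
  [/\ #|vtrans| = q, #|xtrans| = 1%N & #|[set x.1 | x in xparts]| = (q ^ 2 - 1)%N].
Proof.
set n := #|[set x.1 | x in xparts]|.
have n_le : (n <= q ^ 2 - 1)%N.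
  rewrite subn1 -card_nz; apply/subset_leq_card/subsetP => c /imsetP[[c1 u] gA ->].
  by rewrite !inE; apply: xparts_neq0 gA.
have q2 : (1 < q ^ 2)%N by rewrite (leq_ltn_trans _ q_lt_sq).
have cardE := card_A; rewrite card_stab_fibers card_xparts_fibers -/n mulnA in cardE.
have dvd_q4 : (#|vtrans| * #|xtrans| %| q ^ 2 * q ^ 2)%N.
  apply: dvdn_mul; apply: card_additive_dvd.
  - exact: vtrans0.
  - exact: vtransD.
  - exact: xtrans0.
  - exact: xtransD.
have cop : coprime (#|vtrans| * #|xtrans|) (q ^ 2 - 1).
  apply: coprime_dvdl dvd_q4 _; rewrite coprimeMl andbb subn1.
  by rewrite coprimenP // expn_gt0 q_gt0.
have /dvdnP[k qE] : (#|vtrans| * #|xtrans| %| q)%N.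
  by rewrite -(Gauss_dvdl _ cop) -cardE dvdn_mulr.
have /andP[k0 VT0] : (0 < k)%N && (0 < #|vtrans| * #|xtrans|)%N.
  by rewrite -muln_gt0 -qE q_gt0.
have nE : n = (k * (q ^ 2 - 1))%N.
  by apply/eqP; rewrite -(eqn_pmul2l VT0) cardE mulnA [(_ * k)%N]mulnC -qE.
have q2' : (0 < q ^ 2 - 1)%N by rewrite subn_gt0.
have k1 : k = 1%N.
  apply/eqP; rewrite eqn_leq k0 andbT; move: n_le.
  by rewrite nE -[X in (_ <= X)%N](mul1n _) leq_pmul2r.
rewrite k1 mul1n in qE; rewrite k1 mul1n in nE.
have xt1 : #|xtrans| = 1%N.
  apply/eqP; rewrite eqn_leq; apply/andP; split; last first.
    by rewrite card_gt0; apply/set0Pn; exists 0; apply: xtrans0.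
  have : (#|xtrans| < n)%N.
    rewrite nE; apply: (@leq_ltn_trans q); last by rewrite ltn_subRL add1n q_lt_sq.
    rewrite [X in (_ <= X)%N]qE leq_pmull //.
    by move: VT0; rewrite muln_gt0 => /andP[].
  apply: contraLR; rewrite -!ltnNge => xt2.
  (* Conjugating one nonzero horizontal translation would produce a different one for each of the
     [n] linear parts, but there are at most q. *)
  have [u ut u0] : exists2 u, u \in xtrans & u != 0.
    have /card_gt0P[u] : (0 < #|(xtrans :\ 0)%R|)%N by rewrite card_setD1 ?xtrans0 // -subn1 subn_gt0.
    by rewrite in_setD1 => /andP[u0 ut]; exists u.
  rewrite ltnS /n -(card_imset (mem [set x.1 | x in xparts]) (nmulIr u0)).
  apply/subset_leq_card/subsetP => z /imsetP[c /imsetP[[c' u'] gA /= ->] ->].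
  have c0 := xparts_neq0 gA; rewrite xtransE in ut.
  have := xparts_comp (xparts_comp (xparts_inv gA) ut) gA.
  rewrite nmul1 nVmul // nmul1 nmulDl nmulNl nmulVK // => gg.
  by rewrite xtransE; move: gg; rewrite [- u' + _]addrC addrNK.
by rewrite xt1 muln1 in qE; split=> //; rewrite -qE.
Qed.

Lemma xparts_uniq c u u' : (c, u) \in xparts -> (c, u') \in xparts -> u = u'.
Proof.
move=> gA gA'; have c0 := xparts_neq0 gA; have [_ xt1 _] := card_trans.
have := xparts_comp (xparts_inv gA) gA'.
rewrite nVmul // nmulNl nmulVK // => gg.
have /cards1P[t tE] : #|xtrans| == 1%N by rewrite xt1.
have := xtrans0; rewrite tE inE => /eqP t0.
have : - u + u' \in xtrans by rewrite xtransE.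
by rewrite tE inE -t0 addrC subr_eq0 => /eqP.
Qed.

Lemma xparts_onto c : c != 0 -> exists u, (c, u) \in xparts.
Proof.
move=> c0; have [_ _ cc] := card_trans.
have : [set x.1 | x in xparts] = [set~ 0].
  apply: eq_of_subset_leq_card; last by rewrite cc card_nz subn1.
  apply/subsetP => c' /imsetP[[c1 u] gA ->].
  by rewrite !inE; apply: xparts_neq0 gA.
move/setP/(_ c); rewrite [in RHS]inE in_set1 c0 => /imsetP[[c1 u] gA ->].
by exists u.
Qed.

(* The central involution [x |-> - x + u] fixes [u / 2]; since the x-part of
   an element is determined by its linear part, everything commuting with it
   modulo translations fixes that point too. *)
Lemma xparts_fixed : exists x0, forall c, c != 0 -> (c, x0 - x0 ⋆ c) \in xparts.
Proof.
have N10 : (-1 : F) != 0 by rewrite oppr_eq0 oner_eq0.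
have [u0 gN] := xparts_onto N10; exists (u0 / 2) => c c0.
have [u gc] := xparts_onto c0.
have := xparts_comp gN gc; have := xparts_comp gc gN.
rewrite nmulNl n1mul !nmulrN !nmul1 => g1 /(xparts_uniq g1) e1.
suff -> : u0 / 2 - u0 / 2 ⋆ c = u by [].
have h2 : u0 / 2 ⋆ c = u0 ⋆ c / 2.
  apply: (mulfI two_neq0).
  have -> : 2 * (u0 / 2 ⋆ c) = (u0 / 2 + u0 / 2) ⋆ c by rewrite nmulDl; ring.
  have -> : u0 / 2 + u0 / 2 = u0 by field; exact: two_neq0.
  by field; exact: two_neq0.
rewrite h2; apply: (mulfI two_neq0).
transitivity (u0 - u0 ⋆ c); first by field; exact: two_neq0.
transitivity ((- u + u0) + u - u0 ⋆ c); first by ring.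
by rewrite e1; ring.
Qed.

Lemma col_vtrans x y y' : y \in col A x -> (y' \in col A x) = (y' - y \in vtrans).
Proof.
move=> yA; have [vq _ _] := card_trans.
have -> : col A x = [set y + v | v in vtrans].
  apply/esym; apply: eq_of_subset_leq_card; last by rewrite card_imset ?vq ?Aun.1 //; apply: addrI.
  apply/subsetP => z /imsetP[v]; rewrite vtransE => /stabP[_ _ gv] ->.
  by move: yA; rewrite !inE => /gv; rewrite !nmul1 addr0.
apply/imsetP/idP => [[v vV ->]|vV]; first by rewrite addrC addKr.
by exists (y' - y); rewrite // addrC subrK.
Qed.

(** The new origin lies in the column fixed by the chosen lifts, and any point of the set in that
    column will do. *)
Lemma stab_normalised : exists B : {set F * F},
  [/\ proj_equiv q (stdU A) (stdU B), affine_unital B, 0 \in col B 0,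
      forall v, v \in col B 0 -> ((1, 0), (1, v)) \in stab B &
      forall c, c != 0 -> exists d, ((c, 0), (d, 0)) \in stab B].
Proof.
have [x0 x0P] := xparts_fixed.
have [y0 y0A] : exists y0, y0 \in col A x0.
  by apply/set0Pn; rewrite -card_gt0 Aun.1 q_gt0.
pose B := [set (z.1 ⋆ 1 + - x0, z.2 ⋆ 1 + - y0) | z in A].
have BE x y : ((x, y) \in B) = ((x + x0, y + y0) \in A).
  apply/imsetP/idP => [[[x' y'] zA [-> ->]]|zA].
    by rewrite !nmul1 !subrK.
  by exists (x + x0, y + y0); rewrite // !nmul1 !addrK.
have colB x y : (y \in col B x) = (y + y0 \in col A (x + x0)) by rewrite !inE BE.
have vB v : v \in col B 0 -> ((1, 0), (1, v)) \in stab B.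
  rewrite colB add0r (col_vtrans _ y0A) addrK vtransE => /stabP[_ _ gv].
  apply/stabP; rewrite !oner_eq0; split=> // x y; rewrite !BE => /gv.
  by rewrite !nmul1 !addr0 addrAC.
exists B; split=> //.
- exact: (proj_equiv_phi (- x0) (- y0) (oner_neq0 F) (oner_neq0 F) A).
- split=> [x|m b].
    rewrite -(Aun.1 (x + x0)) -(card_imset (mem (col B x)) (addIr y0)).
    congr #|pred_of_set _|; apply/setP => y; apply/imsetP/idP.
      by case=> y'; rewrite colB => yA ->.
    by move=> yA; exists (y - y0); rewrite ?colB subrK.
  suff -> : #|sec B m b| = #|sec A m (b + y0 - x0 ⋆ m)| by apply: Aun.2.
  rewrite -(card_imset (mem (sec B m b)) (addIr x0)).
  have E x : (x + x0) ⋆ m + (b + y0 - x0 ⋆ m) = x ⋆ m + b + y0 by rewrite nmulDl; ring.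
  congr #|pred_of_set _|; apply/setP => x; apply/imsetP/idP.
    by case=> x'; rewrite inE BE => yA ->; rewrite inE E.
  move=> xA; exists (x - x0); rewrite ?subrK // inE BE -E subrK.
  by move: xA; rewrite inE.
- by rewrite colB !add0r.
move=> c c0; have /imsetP[[[c1 u] [d v]] gA /= [cE uE]] := x0P c c0.
rewrite -cE -uE in gA; have [_ d0 gP] := stabP _ _ _ _ _ gA.
exists d; apply/stabP; split=> // x y; rewrite !BE !addr0 => zA.
have := gP x0 y0; rewrite inE in y0A; move=> /(_ y0A).
have -> : x0 ⋆ c + (x0 - x0 ⋆ c) = x0 by ring.
move=> y0A'.
(* The element may still move (x0, y0) along its column. A vertical translation corrects this
   without changing [d]. *)
have : y0 ⋆ d + v \in col A x0 by rewrite inE.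
rewrite (@col_vtrans _ y0); last by rewrite inE.
move=> /vtransN; rewrite vtransE => /stabP[_ _ gv].
have := gv _ _ (gP _ _ zA); rewrite !nmul1 !nmulDl addr0.
congr ((_, _) \in A); ring.
Qed.
End Stabiliser.

(** * Reduction to the model *)

Lemma nmulZ (t x y : F) : t \in Fq -> (t * x) ⋆ y = t * (x ⋆ y).
Proof.
by move=> /FqP tq; rewrite !nmulE; case: ifP => _; rewrite ?exprMn ?tq mulrA.
Qed.

(** Scaling [y] by [d] sends [w] to [eps] and [a] to a0 + a1 eps with a0 nonzero, because [a / w] is
    not in [Fq]. A scaling of [x] by an element of norm a0 absorbs a0, and the parameter [t] absorbs
    a1. *)
Lemma model_equiv (A : {set F * F}) (a w eps : F) :
  eps != 0 -> eps ^+ q = - eps -> w != 0 -> a / w \notin Fq ->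
  (forall x y, ((x, y) \in A) = ((y - a * Nm q x) / w \in Fq)) ->
  proj_equiv q (stdU A) (model_unital q eps).
Proof.
move=> eps0 epsq w0 aw AE.
have epsF : eps \notin Fq.
  apply/negP => /FqP; rewrite epsq => /eqP.
  rewrite eq_sym -subr_eq0 opprK -mulr2n -mulr_natl mulf_eq0 (negPf eps0) orbF.
  by rewrite (negPf two_neq0).
pose d := ninv w ⋆ eps; have d0 : d != 0 by rewrite nmul_eq0 negb_or ninv_eq0 w0.
have wd : w ⋆ d = eps by rewrite nmulA nmulV // n1mul.
have [a0 [a1 [a0q a1q ad]]] := Fq_basis (a ⋆ d) epsF.
have a00 : a0 != 0.
  apply: contraNneq aw => a00; move: ad; rewrite a00 add0r -wd -nmulZ //.
  by move/(nmulIl d0) => ->; rewrite mulfK.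
have [c c0 cN] := Nm_onto a0q a00.
have dE s r : s \in Fq -> r \in Fq -> (a * s + r * w) ⋆ d = a0 * s + (a1 * s + r) * eps.
  by move=> sq rq; rewrite nmulDl [a * s]mulrC !nmulZ // ad wd; ring.
apply: proj_equiv_trans (proj_equiv_phi 0 0 c0 d0 A) _.
set B := [set _ | z in A]; suff -> : stdU B = model_unital q eps.
  exists 1%g; first by apply/collineationP => L; exists L => P; rewrite perm1.
  by rewrite -[RHS]imset_id; apply: eq_imset => P; rewrite perm1.
congr (_ :|: _); apply/setP => P; apply/imsetP/imset2P.
  case=> z /imsetP[[x y] zA ->] -> /=; rewrite !addr0.
  rewrite AE in zA; set t := (y - a * Nm q x) / w in zA.
  have -> : y = a * Nm q x + t * w by rewrite /t divfK // addrC subrK.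
  exists (x ⋆ c) (a1 * Nm q x + t) => //.
    exact: FqD (FqM a1q (Nm_Fq x)) zA.
  by rewrite dE ?Nm_Fq // Nm_nmul cN [Nm q x * a0]mulrC.
case=> x t _ tq ->; rewrite -/Fq in tq.
pose x' := x ⋆ ninv c; have xE : x = x' ⋆ c by rewrite nmulVK.
pose y' := a * Nm q x' + (t - a1 * Nm q x') * w.
have rq : t - a1 * Nm q x' \in Fq by rewrite FqB ?FqM ?Nm_Fq.
exists (x' ⋆ c + 0, y' ⋆ d + 0).
  apply/imsetP; exists (x', y') => //.
  by rewrite AE /y' addrC addKr mulfK.
rewrite /= !addr0 -xE dE ?Nm_Fq // [in Nm q x]xE Nm_nmul cN.
by congr affine; ring.
Qed.

(** * The nearfield of order nine *)

Lemma char_order9 : q = 3 -> (3 : F) = 0.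
Proof.
move=> q3; have -> : (3 : F) = q%:R by rewrite q3.
rewrite hq natrX; have /andP[_ /eqP ->] := pcharF.
by rewrite expr0n; case: (e) he.
Qed.

Lemma Fq_order3 (t : F) : q = 3 -> t \in Fq -> [\/ t = 0, t = 1 | t = -1].
Proof.
move=> q3 /FqP; rewrite q3 => t3.
have : t * ((t - 1) * (t + 1)) = 0.
  by transitivity (t ^+ 3 - t); [ring | rewrite t3 subrr].
move/eqP; rewrite !mulf_eq0 subr_eq0 addr_eq0 => /or3P[]/eqP->.
- exact: Or31.
- exact: Or32.
- exact: Or33.
Qed.

(* For q = 3 the nonzero elements form the quaternion group Q8; if y ^+ 2 = 1 - y
   this is the nearfield automorphism of order 3 that fixes 1 and maps y to - y ^+ 2. *)
Definition quat_aut (y x : F) : F := x - (x - x ^+ q) / y ^+ 2.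

Lemma quat_autD y x z : quat_aut y (x + z) = quat_aut y x + quat_aut y z.
Proof. by rewrite /quat_aut frobD; ring. Qed.

Lemma quat_autZ y t x : t \in Fq -> quat_aut y (t * x) = t * quat_aut y x.
Proof. by move=> /FqP tq; rewrite /quat_aut exprMn tq; ring. Qed.

Lemma quat_aut0 y : quat_aut y 0 = 0.
Proof. by rewrite /quat_aut frob0 subrr mul0r subr0. Qed.

Lemma quat_aut1 y : quat_aut y 1 = 1.
Proof. by rewrite /quat_aut expr1n subrr mul0r subr0. Qed.

Lemma quat_autN y x : quat_aut y (- x) = - quat_aut y x.
Proof. by rewrite -mulN1r quat_autZ ?mulN1r // FqN ?Fq1. Qed.

Section OrderNine.
Hypothesis q3 : q = 3.
Variable y : F.
Hypothesis y2 : y ^+ 2 = 1 - y.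

Let three0 := char_order9 q3.

Let y3 : y ^+ 3 = - 1 - y.
Proof.
have -> : y ^+ 3 = y * y ^+ 2 by ring.
rewrite y2 mulrBr -expr2 y2; apply/eqP; rewrite -subr_eq0; apply/eqP.
transitivity (y * 3); first by ring.
by rewrite three0 mulr0.
Qed.

(** So [y] has order 8 in the multiplicative group of the field, and its odd powers are the
    nonsquares. *)
Let y4 : y ^+ 4 = -1.
Proof.
have -> : y ^+ 4 = y * y ^+ 3 by ring.
by rewrite y3 mulrBr -expr2 y2; ring.
Qed.

Let y0 : y != 0.
Proof.
apply/negP => /eqP y0; have := y4; rewrite y0 expr0n /= => /eqP.
by rewrite eq_sym oppr_eq0 oner_eq0.
Qed.

Let h4 : euler_exp = 4%N. Proof. by rewrite /euler_exp q3. Qed.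

Let y_nsq : is_square y = false.
Proof. by rewrite is_squareE // h4 y4 (negPf one_neqN1). Qed.

Let y3_nsq : is_square (y ^+ 3) = false.
Proof. by have <- : y ^+ q = y ^+ 3 by [rewrite q3]; rewrite is_square_frob. Qed.

Let y_nFq : y \notin Fq.
Proof. by apply/negP => /FqP/is_square_Fq; rewrite y_nsq. Qed.

(** These are the nine combinations of 1 and [y] over F_3, rewritten so that products need checking
    on four right factors only. *)
Lemma order9_elements (x : F) : x = 0 \/ exists s, (s = 1 \/ s = -1) /\
  [\/ x = s, x = s * y, x = s * y ^+ 2 | x = s * y ^+ 3].
Proof.
have [s [t [/(Fq_order3 q3) sq /(Fq_order3 q3) tq ->]]] := Fq_basis x y_nFq.
case: sq => ->; case: tq => ->.
- by left; rewrite mul0r addr0.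
- by right; exists 1; split; [left|constructor 2; rewrite add0r].
- by right; exists (-1); split; [right|constructor 2; rewrite add0r].
- by right; exists 1; split; [left|constructor 1; rewrite mul0r addr0].
- by right; exists (-1); split; [right|constructor 4; rewrite y3; ring].
- by right; exists 1; split; [left|constructor 3; rewrite y2; ring].
- by right; exists (-1); split; [right|constructor 1; rewrite mul0r addr0].
- by right; exists (-1); split; [right|constructor 3; rewrite y2; ring].
- by right; exists 1; split; [left|constructor 4; rewrite y3; ring].
Qed.

Local Notation sig := (quat_aut y).

Let sigS s x : s = 1 \/ s = -1 -> sig (s * x) = s * sig x.
Proof. by move=> s1; apply: quat_autZ; case: s1 => ->; rewrite ?FqN ?Fq1. Qed.

Let sigy : sig y = - y ^+ 2.
Proof.
rewrite /quat_aut q3 y3; have -> : y - (-1 - y) = y ^+ 2.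
  rewrite y2; apply/eqP; rewrite -subr_eq0; apply/eqP.
  by transitivity (y * 3); [ring | rewrite three0 mulr0].
by rewrite divff ?expf_neq0 // y2; ring.
Qed.

Let sigy2 : sig (y ^+ 2) = y ^+ 3.
Proof.
rewrite {1}y2 quat_autD quat_autN quat_aut1 sigy y3 y2 opprK.
apply/eqP; rewrite -subr_eq0; apply/eqP.
by transitivity (3 : F); [ring | rewrite three0].
Qed.

Let sigy3 : sig (y ^+ 3) = - y.
Proof. by rewrite {1}y3 quat_autD !quat_autN quat_aut1 sigy y2; ring. Qed.

Let nmulS (s x z : F) : s = 1 \/ s = -1 -> x ⋆ (s * z) = s * (x ⋆ z).
Proof. by case=> ->; rewrite ?mul1r // !mulN1r nmulrN. Qed.

Let sig_y (z : F) : sig (y ⋆ z) = sig y ⋆ sig z.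
Proof.
have sy2 : is_square (- y ^+ 2) by rewrite is_squareN is_squareX2.
case: (order9_elements z) => [->|[s [s1 zE]]].
  by rewrite nmul0 quat_aut0 nmul0.
have [u [-> uE]] : exists u, z = s * u /\ [\/ u = 1, u = y, u = y ^+ 2 | u = y ^+ 3].
  case: zE => ->.
  - by exists 1; split; [rewrite mulr1 | constructor 1].
  - by exists y; split; last constructor 2.
  - by exists (y ^+ 2); split; last constructor 3.
  - by exists (y ^+ 3); split; last constructor 4.
rewrite (sigS _ s1) !(nmulS _ _ s1) (sigS _ s1); congr (_ * _); rewrite sigy; case: uE => ->.
- by rewrite quat_aut1 !nmul1 sigy.
- rewrite sigy !nmulE y_nsq sy2 q3; have -> : y ^+ 3 * y = -1 by rewrite -y4; ring.
  by rewrite quat_autN quat_aut1 -y4; ring.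
- rewrite sigy2 !nmulE is_squareX2 y3_nsq q3.
  have -> : y * y ^+ 2 = y ^+ 3 by ring.
  rewrite sigy3; have -> : (- y ^+ 2) ^+ 3 * y ^+ 3 = - (y ^+ 4 * y ^+ 4 * y) by ring.
  by rewrite y4; ring.
- rewrite sigy3 !nmulE y3_nsq is_squareN y_nsq q3.
  have -> : y ^+ 3 * y ^+ 3 = - (y ^+ 2).
    by transitivity (y ^+ 4 * y ^+ 2); [ring | rewrite y4; ring].
  rewrite quat_autN sigy2; have -> : (- y ^+ 2) ^+ 3 * - y = y ^+ 4 * y ^+ 3 by ring.
  by rewrite y4; ring.
Qed.

(** Both sides are additive and F_3-linear in the left factor, so it suffices to treat the left
    factors 1 and [y]. *)
Lemma quat_autM (x z : F) : sig (x ⋆ z) = sig x ⋆ sig z.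
Proof.
have [s [t [sq tq ->]]] := Fq_basis x y_nFq.
rewrite nmulDl -[s]mulr1 !nmulZ // n1mul !quat_autD !quat_autZ //.
by rewrite quat_aut1 nmulDl !nmulZ // n1mul sig_y.
Qed.

(** The set is the cyclic subgroup of order 4 generated by [y] under [nmul]. Up to sign [sig] sends
    [y] to [y ^+ 2], a square, but [y ^+ 2] and [y ^+ 3] to nonsquares. *)
Lemma is_square_quat_aut (x : F) : x != 0 ->
  is_square (sig x) = (x \in [set 1; -1; y; - y]).
Proof.
have sqS (s z : F) : s = 1 \/ s = -1 -> is_square (s * z) = is_square z.
  by case=> ->; rewrite ?mul1r ?mulN1r ?is_squareN.
move=> x0; case: (order9_elements x) => [xE|[s [s1 xE]]].
  by rewrite xE eqxx in x0.
have sig_in : x \in [set 1; -1; y; - y] -> is_square (sig x).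
  rewrite !inE -!orbA => /or4P[]/eqP->; rewrite ?quat_autN ?is_squareN ?quat_aut1 ?sigy ?is_square1 //.
    by rewrite is_squareN is_squareX2.
  by rewrite is_squareN is_squareX2.
apply/idP/idP => //.
case: xE => ->.
- by move=> _; rewrite !inE; case: s1 => ->; rewrite eqxx ?orbT.
- by move=> _; rewrite !inE; case: s1 => ->; rewrite ?mul1r ?mulN1r eqxx ?orbT.
- by rewrite (sigS _ s1) sigy2 (sqS _ _ s1) y3_nsq.
- by rewrite (sigS _ s1) sigy3 (sqS _ _ s1) is_squareN y_nsq.
Qed.

Lemma quat_aut_inj : injective sig.
Proof.
move=> x z exz; apply/eqP; rewrite -subr_eq0; apply/negPn/negP => xz0.
have : sig (x - z) = 0 by rewrite quat_autD quat_autN exz subrr.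
have : sig (x - z) ⋆ sig (ninv (x - z)) = 1.
  by rewrite -quat_autM nmulV // quat_aut1.
move=> e1 e0; move: e1; rewrite e0 n0mul => /eqP; by rewrite eq_sym oner_eq0.
Qed.

Lemma quat_aut_eq0 x : (sig x == 0) = (x == 0).
Proof. by rewrite -{1}(quat_aut0 y) (inj_eq quat_aut_inj). Qed.

Lemma card_order9_subgroup : #|[set 1; -1; y; - y]| = 4%N.
Proof.
have yN1 s : s = 1 \/ s = -1 -> (s == y) = false.
  by move=> s1; apply/eqP => sy; move: y_nsq; rewrite -sy;
    case: s1 => ->; rewrite ?is_squareN is_square1.
have yNy : (y == - y) = false.
  apply/negbTE; rewrite -subr_eq0 opprK -mulr2n -mulr_natl.
  by rewrite mulf_neq0 ?two_neq0 ?y0.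
have y1 : (1 == y) = false by apply: yN1; left.
have yN : (-1 == y) = false by apply: yN1; right.
have y1N : (1 == - y) = false by rewrite -eqr_oppLR yN.
have yNN : (-1 == - y) = false by rewrite eqr_opp y1.
by rewrite -!setUA !cardsU1 cards1 !inE yNy y1 yN y1N yNN [1 == -1]eq_sym (negPf one_neqN1).
Qed.
End OrderNine.

(** * Unitals invariant under a normalised group *)

Section Normalised.
Variable A : {set F * F}.
Hypothesis Aun : affine_unital A.
Hypothesis A00 : 0 \in col A 0.
Hypothesis vst : forall v, v \in col A 0 -> ((1, 0), (1, v)) \in stab A.
Hypothesis hst : forall c, c != 0 -> exists d, ((c, 0), (d, 0)) \in stab A.

Local Notation V := (col A 0).
Definition scales c d := ((c, 0), (d, 0)) \in stab A.

Lemma scalesP c d : reflect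
  [/\ c != 0, d != 0 & forall x y, (x, y) \in A -> (x ⋆ c, y ⋆ d) \in A] (scales c d).
Proof.
apply: (iffP (stabP A c 0 d 0)) => -[c0 d0 g]; split=> // x y /g.
  by rewrite !addr0.
by rewrite !addr0.
Qed.

Lemma scalesM c d c' d' : scales c d -> scales c' d' -> scales (c ⋆ c') (d ⋆ d').
Proof. by move=> /stab_comp g /g; rewrite !n0mul !addr0. Qed.

Lemma scalesV c d : scales c d -> scales (ninv c) (ninv d).
Proof. by move=> /stab_inv; rewrite !n0mul !oppr0. Qed.

Lemma scales1 d : scales 1 d -> d = 1.
Proof. exact: (stab_homology Aun). Qed.

Lemma scales11 : scales 1 1.
Proof. exact: stab_id. Qed.

Lemma card_V : #|V| = q. Proof. exact: Aun.1. Qed.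

Lemma col_shift x y y' : y \in col A x -> (y' \in col A x) = (y' - y \in V).
Proof.
move=> yA; have -> : col A x = [set y + v | v in V].
  apply/esym; apply: eq_of_subset_leq_card; last first.
    by rewrite (card_imset _ (addrI y)) card_V Aun.1.
  apply/subsetP => z /imsetP[v vV ->]; have /stabP[_ _ gv] := vst vV.
  by move: yA; rewrite !inE => /gv; rewrite !nmul1 addr0.
apply/imsetP/idP => [[v vV ->]|vV]; first by rewrite addrC addKr.
by exists (y' - y); rewrite // addrC subrK.
Qed.

Lemma VB v v' : v \in V -> v' \in V -> v - v' \in V.
Proof. by move=> vV v'V; rewrite -(col_shift _ v'V). Qed.

Lemma V_scales c d v : scales c d -> v \in V -> v ⋆ d \in V.
Proof. by move=> /scalesP[_ _ g]; rewrite !inE => /g; rewrite n0mul. Qed.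

Definition ydil : {set F} := [set d | [exists c, scales c d]].
Definition yfix : {set F} := [set c | scales c 1].

Lemma yfixE c : (c \in yfix) = scales c 1. Proof. exact: in_set. Qed.

Lemma ydilP d : reflect (exists c, scales c d) (d \in ydil).
Proof. by rewrite inE; apply: existsP. Qed.

Lemma ydil_neq0 d : d \in ydil -> d != 0.
Proof. by case/ydilP => c /scalesP[]. Qed.

Lemma yfix_neq0 c : c \in yfix -> c != 0.
Proof. by rewrite yfixE => /scalesP[]. Qed.

Lemma yfixM c c' : c \in yfix -> c' \in yfix -> c ⋆ c' \in yfix.
Proof. by rewrite !yfixE => g /(scalesM g); rewrite nmul1. Qed.

Lemma yfix1 : 1 \in yfix. Proof. by rewrite yfixE scales11. Qed.

Lemma exists_Vnz : exists2 w, w \in V & w != 0.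
Proof.
have /card_gt0P[w] : (0 < #|(V :\ 0)%R|)%N.
  by rewrite card_setD1 // card_V -subn1 subn_gt0 (leq_trans _ q_ge3).
by rewrite in_setD1 => /andP[w0 wV]; exists w.
Qed.

(** These multipliers act on the nonzero elements of [V], and the image of a single [w] determines
    the multiplier. *)
Lemma card_ydil_le : (#|ydil| <= q.-1)%N.
Proof.
have [w wV w0] := exists_Vnz.
rewrite -card_V -(card_setD1 A00) -(card_imset (mem ydil) (nmulIr w0)).
apply/subset_leq_card/subsetP => z /imsetP[d dD ->].
rewrite in_setD1 nmul_eq0 negb_or w0 ydil_neq0 //=.
by have /ydilP[c g] := dD; apply: V_scales g wV.
Qed.

(** A horizontal line at height [b] outside [V] meets [A] only off the column of 0. It is preserved
    by [yfix], which acts semiregularly on its at most q + 1 points of [A]. *)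
Lemma card_yfix_le : (#|yfix| <= q.+1)%N.
Proof.
have [b bV] : exists b, b \notin V.
  have /subsetPn[b _ bV] : ~~ ([set: F] \subset V).
    apply/negP => /subset_leq_card; rewrite card_V cardsT hF leqNgt.
    by rewrite (ltn_trans (ltnSn q) q_lt_sq).
  by exists b.
have sb : (0 < #|sec A 0%R b|)%N && (#|sec A 0%R b| <= q.+1)%N.
  by case: (Aun.2 0 b) => ->; rewrite ?leqnn.
case/andP: sb => /card_gt0P[x xb] sb; apply: leq_trans sb.
have x0 : x != 0.
  by apply: contraNneq bV => x0; move: xb; rewrite !inE x0 n0mul add0r.
rewrite -(card_imset (mem yfix) (nmulIr x0)).
apply/subset_leq_card/subsetP => z /imsetP[c]; rewrite yfixE => /scalesP[_ _ g] ->.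
by move: xb; rewrite !inE !nmul0 !add0r => /g; rewrite nmul1.
Qed.

(** The q^2 - 1 nonzero [c] fall into at most q - 1 classes by multiplier, each inside a coset of
    [yfix]; so both upper bounds are attained. *)
Lemma card_dil : #|yfix| = q.+1 /\ #|ydil| = q.-1.
Proof.
pose dd c := odflt 1 [pick d | scales c d].
have ddP c : c != 0 -> scales c (dd c).
  by move=> /hst[d g]; rewrite /dd; case: pickP => [//|/(_ d)]; rewrite /scales g.
have le1 : ((q ^ 2).-1 <= #|yfix| * #|ydil|)%N.
  rewrite -card_nz; apply: (card_le_fibers (f := dd)) => [c|d _].
    by rewrite !inE => /ddP g; apply/existsP; exists c.
  have [->|/set0Pn[c0]] := eqVneq [set c in [set~ 0] | dd c == d] set0.
    by rewrite cards0.
  rewrite !inE => /andP[c00 /eqP dE]; have g0 := ddP _ c00; rewrite dE in g0.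
  have [_ d0 _] := scalesP _ _ g0.
  have v0 : ninv c0 != 0 by rewrite ninv_eq0.
  rewrite -(card_imset (mem [set c in [set~ 0] | dd c == d]) (nmulIl v0)).
  apply/subset_leq_card/subsetP => z /imsetP[c]; rewrite !inE => /andP[cn /eqP cE] ->.
  by have := scalesM (ddP _ cn) (scalesV g0); rewrite cE nmulV.
have le2 := card_yfix_le; have le3 := card_ydil_le.
have qE : (q ^ 2).-1 = (q.+1 * q.-1)%N.
  by rewrite -{3}(prednK q_gt0) -subn1 -{2}(exp1n 2) subn_sqr subn1 addn1 mulnC prednK ?q_gt0.
have q10 : (0 < q.-1)%N by rewrite -subn1 subn_gt0 (leq_trans _ q_ge3).
rewrite qE in le1; split; apply/eqP; rewrite eqn_leq.
  rewrite le2 -(leq_pmul2r q10) (leq_trans le1) //.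
  by rewrite leq_mul2l le3 orbT.
rewrite le3 -(leq_pmul2l (ltn0Sn q)) (leq_trans le1) //.
by rewrite leq_mul2r le2 orbT.
Qed.

(** Right multiplication by one nonsquare of [S] sends the nonsquares of [S] injectively to squares
    of [S]. *)
Lemma card_squares_half (S : {set F}) : 0 \notin S -> 
  (forall x y, x \in S -> y \in S -> x ⋆ y \in S) ->
  (#|S| <= #|[set x in S | is_square x]| * 2)%N.
Proof.
move=> S0 SM; have nz x : x \in S -> x != 0 by apply: contraTneq => ->.
rewrite -(cardsID [set x | is_square x] S) muln2 -addnn.
have -> : [set x in S | is_square x] = S :&: [set x | is_square x].
  by apply/setP => x; rewrite !inE.
rewrite leq_add2l.
have [->|/set0Pn[y]] := eqVneq (S :\: [set x | is_square x]) set0.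
  by rewrite cards0.
rewrite !inE => /andP[ny yS]; have y0 := nz y yS.
rewrite -(card_imset (mem (S :\: [set x | is_square x])) (nmulIl y0)).
apply/subset_leq_card/subsetP => z /imsetP[x]; rewrite !inE => /andP[nx xS] ->.
by rewrite SM // is_square_nmul ?nz // (negPf nx) (negPf ny).
Qed.

Lemma ydilM d d' : d \in ydil -> d' \in ydil -> d ⋆ d' \in ydil.
Proof.
move=> /ydilP[c g] /ydilP[c' g']; apply/ydilP.
by exists (c ⋆ c'); apply: scalesM.
Qed.

(* The multipliers of V form a subgroup of Fq containing 0 and the squares in
   ydil, which is too large to be proper. *)
Lemma V_Fq t v : t \in Fq -> v \in V -> t * v \in V.
Proof.
pose E : {set F} := [set k | [forall v in V, k * v \in V]].
have EP k : reflect (forall v, v \in V -> k * v \in V) (k \in E).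
  by rewrite inE; apply: forall_inP.
have EB k k' : k \in E -> k' \in E -> k - k' \in E.
  by move=> /EP kE /EP k'E; apply/EP => x xV; rewrite mulrBl VB ?kE ?k'E.
have EFq : E \subset Fq.
  apply/subsetP => k /EP kE; apply/FqP.
  have [->|k0] := eqVneq k 0; first exact: frob0.
  have : k ^+ #|V :\ 0| = 1.
    apply: expr_card_stable => //; first by rewrite in_setD1 eqxx.
    move=> x; rewrite !in_setD1 mulf_eq0 negb_or k0 andbT => /andP[-> xV] /=.
    by rewrite mulrC kE.
  rewrite card_setD1 // card_V => kq.
  by rewrite -(prednK q_gt0) exprS kq mulr1.
(* At least (q - 1) / 2 squares in [ydil], together with 0, exceed half of q. *)
have cE : (q < #|E| * 2)%N.
  have sub : 0 |: [set d in ydil | is_square d] \subset E.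
    apply/subsetP => d /setU1P[->|].
      by apply/EP => x _; rewrite mul0r.
    rewrite inE => /andP[/ydilP[c g] sd]; apply/EP => x xV.
    by have := V_scales g xV; rewrite nmulE sd mulrC.
  have n0 : 0 \notin ydil by apply/negP => /ydil_neq0; rewrite eqxx.
  have := card_squares_half n0 ydilM; rewrite card_dil.2 => le1.
  have := subset_leq_card sub; rewrite cardsU1 inE (negPf n0) add1n => le2.
  apply: (@leq_trans (#|[set d in ydil | is_square d]|.+1 * 2)); last by rewrite leq_mul2r le2.
  by rewrite mulSn -{1}(prednK q_gt0) add2n !ltnS.
suff tE : forall t, t \in Fq -> t \in E by move=> /tE/EP; apply.
move=> s sq; apply/negPn/negP => sE.
(* A second coset of [E] inside [Fq] would give more than q elements. *)
pose sE' := [set s + k | k in E].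
have dis : [disjoint E & sE'].
  rewrite -setI_eq0; apply/eqP/setP => k; rewrite [RHS]inE.
  apply/negbTE/negP => /setIP[kE /imsetP[k' k'E kk]].
  by case/negP: sE; rewrite -(addrK k' s) -kk EB.
have : (#|E :|: sE'| <= #|Fq|)%N.
  apply/subset_leq_card; rewrite subUset EFq; apply/subsetP => z /imsetP[k kE ->].
  by rewrite FqD // (subsetP EFq).
rewrite cardsU disjoint_setI0 // cards0 subn0 (card_imset _ (addrI s)) card_Fq.
by rewrite addnn -muln2 leqNgt cE.
Qed.

(** * The height function and its ovoid *)

Variable eps : F.
Hypotheses (eps0 : eps != 0) (epsq : eps ^+ q = - eps).
Variable w : F.
Hypotheses (wV : w \in V) (w0 : w != 0).

(** An F_q-linear functional with kernel [V]: at [w] it is the trace of [eps] times a norm, which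
    vanishes since [eps ^+ q = - eps]. *)
Definition ycoord y := Tr (eps * w ^+ q * y).

Lemma in_V_div y : (y \in V) = (y / w \in Fq).
Proof.
have -> : V = [set t * w | t in Fq].
  apply/esym; apply: eq_of_subset_leq_card; last by rewrite (card_imset _ (mulIf w0)) card_Fq card_V.
  by apply/subsetP => z /imsetP[t tq ->]; apply: V_Fq.
apply/imsetP/idP => [[t tq ->]|yw]; first by rewrite mulfK.
by exists (y / w) => //; rewrite divfK.
Qed.

Lemma ycoord_eq0 y : (ycoord y == 0) = (y \in V).
Proof.
rewrite in_V_div inE /ycoord /Tr !exprMn frobK epsq exprVn.
have wq0 : w ^+ q != 0 by rewrite frob_eq0.
rewrite eqr_div // -[RHS](inj_eq (mulfI eps0)) -[RHS]subr_eq0.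
rewrite -[RHS]oppr_eq0; congr (_ == 0); ring.
Qed.

Lemma ycoordB y y' : ycoord (y - y') = ycoord y - ycoord y'.
Proof. by rewrite /ycoord mulrBr TrB. Qed.

(* The points of A over x are the y with this coordinate modulo the line V. *)
Definition height x := ycoord (odflt 0 [pick y in col A x]).

Lemma heightE x y : ((x, y) \in A) = (ycoord y == height x).
Proof.
rewrite -[LHS](in_set (fun y => (x, y) \in A)) -/(col A x) /height.
case: pickP => [y' y'A|none]; last first.
  have : col A x = set0 by apply/setP => z; rewrite none inE.
  move/(congr1 (fun S : {set F} => #|S|)); rewrite cards0 Aun.1 => q0.
  by have := q_gt0; rewrite q0.
by rewrite /= (col_shift _ y'A) -ycoord_eq0 ycoordB subr_eq0.
Qed.

Lemma height_ycoord x : exists y, height x = ycoord y.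
Proof. by eexists; apply: erefl. Qed.

(** The coefficient of the functional induced by slope [m]. For nonsquare [m] the conjugation of [x]
    is moved across the trace, and conjugating [eps] gives the sign. *)
Definition slope_coord m := if is_square m then eps * w ^+ q * m else - (eps * w * m ^+ q).

Lemma ycoord_nmul x m : ycoord (x ⋆ m) = Tr (slope_coord m * x).
Proof.
rewrite /ycoord nmulE /slope_coord; case: ifP => sm.
  by congr Tr; ring.
rewrite /Tr !(exprMn, frobN, frobK) epsq; ring.
Qed.

(** As [w] and [w ^+ q] have the same square class, the two branches take values in opposite classes
    and cannot collide; each branch is injective by itself. *)
Lemma slope_coord_inj : injective slope_coord.
Proof.
have wq0 : w ^+ q != 0 by rewrite frob_eq0.
have sc m : m != 0 -> is_square (slope_coord m) = (is_square (eps * w) == is_square m).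
  move=> m0; rewrite /slope_coord; case: ifP => sm.
    rewrite is_squareM ?mulf_neq0 // sm (is_squareM eps0 wq0) is_square_frob.
    by rewrite (is_squareM eps0 w0).
  by rewrite is_squareN is_squareM ?mulf_neq0 ?frob_eq0 // is_square_frob sm.
have sc0 m : (slope_coord m == 0) = (m == 0).
  rewrite /slope_coord; case: ifP => _; rewrite ?oppr_eq0 !mulf_eq0 ?frob_eq0;
    by rewrite (negPf eps0) (negPf w0).
move=> m m' emm'; have [m0|m0] := eqVneq m 0.
  by apply/eqP; rewrite m0 eq_sym -sc0 -emm' sc0 m0.
have m'0 : m' != 0 by rewrite -sc0 -emm' sc0.
have := sc m m0; rewrite emm' sc // => smm'.
have {}smm' : is_square m' = is_square m.
  by move: smm'; case: (is_square _); case: (is_square m); case: (is_square m').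
move: emm'; rewrite /slope_coord smm'; case: ifP => _.
  by apply: mulfI; rewrite mulf_neq0.
by move/oppr_inj/(mulfI (mulf_neq0 eps0 w0))/frob_inj.
Qed.

Lemma height_ovoidal : ovoidal height.
Proof.
split=> [x|k b bq]; first exact: Tr_Fq.
have [m ->] : exists m, k = slope_coord m.
  have : [set slope_coord m | m in [set: F]] = setT.
    by apply: eq_of_subset_leq_card; rewrite ?subsetT // card_imset //; apply: slope_coord_inj.
  by move/setP/(_ k); rewrite [in RHS]inE => /imsetP[m _ ->]; exists m.
have wq0 : w ^+ q != 0 by rewrite frob_eq0.
(* The division by 2 compensates for the trace being doubling on [Fq]. *)
pose b' := b / 2 / (eps * w ^+ q).
have bE : ycoord b' = b.
  rewrite /ycoord /b' mulrCA mulfV ?mulf_neq0 // mulr1 TrZ //.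
    rewrite /Tr exprVn frob2; field; exact: two_neq0.
suff -> : [set x | height x == Tr (slope_coord m * x) + b] = sec A m b' by apply: Aun.2.
apply/setP => x; rewrite !inE heightE -ycoord_nmul -[b in LHS]bE eq_sym.
by rewrite /ycoord mulrDr TrD.
Qed.

Lemma height0 : height 0 = 0.
Proof.
have := A00; rewrite inE heightE => /eqP <-.
by rewrite /ycoord mulr0 /Tr frob0 addr0.
Qed.

Lemma height_scales c x : scales c 1 -> height (x ⋆ c) = height x.
Proof.
move=> /scalesP[_ _ g]; have [y hy] := height_ycoord x.
have : (x, y) \in A by rewrite heightE hy.
by move/g; rewrite nmul1 heightE hy => /eqP.
Qed.

(** The multiplier [d] of -1 satisfies [d ⋆ d = 1]. If it were a nonsquare it would have norm 1 and
    thus be a square, so it is 1 or -1; the latter would make the height odd. *)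
Lemma scalesN1 : scales (-1) 1.
Proof.
have N10 : (-1 : F) != 0 by rewrite oppr_eq0 oner_eq0.
have [d g] := hst N10; have [_ d0 gP] := scalesP _ _ g.
have := scalesM g g; rewrite nmulrN nmul1 opprK => /scales1 dd.
suff : d = 1 \/ d = -1.
  case=> dE; first by rewrite dE in g.
  exfalso; apply: (ovoidal_not_odd height_ovoidal) => x.
  have [y hy] := height_ycoord x.
  have : (x, y) \in A by rewrite heightE hy.
  move/gP; rewrite dE !nmulrN !nmul1 heightE => /eqP <-.
  by rewrite hy /ycoord mulrN TrN.
have sd : is_square d.
  case nd: (is_square d) => //; rewrite -nd; apply: is_square_norm1.
  by move: dd; rewrite nmulE nd exprS mulrC.
move/eqP: dd; rewrite nmulE sd -expr2 sqrf_eq1 => /orP[]/eqP->; by [left|right].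
Qed.

Lemma height_even x : height (- x) = height x.
Proof. by have := height_scales x scalesN1; rewrite nmulrN nmul1. Qed.

Lemma level_yfix x : x != 0 ->
  [set x ⋆ c | c in yfix] \subset [set z | height z == height x].
Proof.
move=> x0; apply/subsetP => z /imsetP[c]; rewrite yfixE => g ->.
by rewrite inE height_scales.
Qed.

(** Otherwise the zero level would contain 0 and the q + 1 images of [x] under [yfix], one point too
    many for a plane section. *)
Lemma height_neq0 x : x != 0 -> height x != 0.
Proof.
move=> x0; apply/negP => /eqP hx0.
have := height_ovoidal.2 0 0 Fq0; set S := [set _ | _].
have S0 : 0 \in S by rewrite inE mul0r height0 /Tr frob0 !addr0.
have : (q.+2 <= #|S|)%N.
  have -> : q.+2 = #|0 |: [set x ⋆ c | c in yfix]|.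
    rewrite cardsU1 (card_imset _ (nmulIr x0)) card_dil.1.
    suff -> : 0 \notin [set x ⋆ c | c in yfix] by [].
    apply/imsetP => -[c cM] /esym/eqP; rewrite nmul_eq0 (negPf x0) /=.
    by rewrite (negPf (yfix_neq0 cM)).
  apply/subset_leq_card/subsetP => z /setU1P[->//|/(subsetP (level_yfix x0))].
  by rewrite !inE hx0 mul0r /Tr frob0 !addr0.
by move=> le2 [] e1; move: le2; rewrite e1 ?ltnn // ltnS ltn0.
Qed.

Lemma yfix_norm1 c : c \in yfix -> is_square c -> c ^+ q.+1 = 1.
Proof.
move=> cM sc; rewrite -card_dil.1; apply: expr_card_stable.
- exact: yfix_neq0 cM.
- by apply/negP => /yfix_neq0; rewrite eqxx.
by move=> x xM; have := yfixM xM cM; rewrite nmulE sc.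
Qed.

(** Squares of [yfix] lying in [Fq] have norm 1, so they satisfy c^2 = 1 and number at most two. For
    q > 3 the (q + 1) / 2 or more squares therefore include some [c] outside [Fq]. *)
Lemma height_norm_gt3 : (3 < q)%N -> forall x, height x = height 1 * Nm q x.
Proof.
move=> q3; have n0 : 0 \notin yfix by apply/negP => /yfix_neq0; rewrite eqxx.
have := card_squares_half n0 yfixM; rewrite card_dil.1; set S := [set _ in _ | _] => leS.
have [c cS cq] : exists2 c, c \in S & c \notin Fq.
  apply/subsetPn; apply/negP => SF.
  have : (#|S| <= 2)%N.
    apply: leq_trans (card_exp_le 1 (isT : 0 < 2)%N).
    apply/subset_leq_card/subsetP => c cS; have /FqP cq := subsetP SF c cS.
    rewrite inE; move: cS; rewrite in_set => /andP[cM sc]; have := yfix_norm1 cM sc.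
    by rewrite exprS cq expr2 => ->.
  rewrite -(leq_pmul2r (isT : 0 < 2)%N) => /(leq_trans leS).
  have := q_odd; case: (q) q3 => [|[|[|[|[|n]]]]] //.
move: cS; rewrite in_set => /andP[cM sc].
apply: (ovoidal_norm height_ovoidal height_even height0 q3 cq).
  exact: yfix_norm1.
move=> x; move: cM; rewrite yfixE => /(height_scales x).
by rewrite nmulE sc.
Qed.

Lemma level1_yfix x : height x = height 1 -> x \in yfix.
Proof.
move=> hx; have := height_ovoidal.2 0 (height 1) (height_ovoidal.1 1).
set S := [set _ | _] => cS.
have SE z : (z \in S) = (height z == height 1).
  by rewrite inE mul0r /Tr frob0 addr0 add0r.
have cS' : (#|S| <= q.+1)%N by case: cS => ->; rewrite ?leqnn.
suff -> : yfix = S by rewrite SE hx.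
apply: eq_of_subset_leq_card; last by rewrite card_dil.1.
by apply/subsetP => c; rewrite yfixE SE => /(height_scales 1); rewrite n1mul => ->.
Qed.

(** [s] absorbs the exceptional automorphism needed when q = 3; elsewhere it is the identity. *)
Lemma normal_form_equiv (s : F -> F) :
  (forall x y, s (x + y) = s x + s y) ->
  (forall t x, t \in Fq -> s (t * x) = t * s x) ->
  injective s -> (forall x, height x = height 1 * Nm q (s x)) ->
  proj_equiv q (stdU [set (s z.1, s z.2) | z in A]) (model_unital q eps).
Proof.
move=> sD sZ s_inj hN; have [a ha] := height_ycoord 1.
have s0 : s 0 = 0 by have := sZ 0 0 Fq0; rewrite !mul0r.
have sB x y : s (x - y) = s x - s y.
  by rewrite sD -mulN1r sZ ?FqN ?Fq1 // mulN1r.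
have sw0 : s w != 0 by rewrite -s0 (inj_eq s_inj).
have s_div y : (s y / s w \in Fq) = (y / w \in Fq).
  apply/idP/idP => yq.
    suff -> : y = s y / s w * w by rewrite mulfK.
    by apply: s_inj; rewrite sZ // divfK.
  suff -> : s y = y / w * s w by rewrite mulfK.
  by rewrite -sZ // divfK.
apply: (@model_equiv _ (s a) (s w)) => //.
  rewrite s_div -in_V_div -ycoord_eq0 -ha; exact: height_neq0 (oner_neq0 F).
have s_onto x : exists x0, x = s x0.
  have : [set s z | z in [set: F]] = setT.
    by apply: eq_of_subset_leq_card; rewrite ?subsetT // card_imset.
  by move/setP/(_ x); rewrite [in RHS]inE => /imsetP[z _ ->]; exists z.
move=> x y; have [x0 ->] := s_onto x; have [y0 ->] := s_onto y.
have -> : ((s x0, s y0) \in [set (s z.1, s z.2) | z in A]) = ((x0, y0) \in A).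
  apply/imsetP/idP => [[[x1 y1] zA /= [/s_inj -> /s_inj ->]]|zA] //.
  by exists (x0, y0).
rewrite [s a * _]mulrC -sZ ?Nm_Fq // -sB s_div -in_V_div -ycoord_eq0.
rewrite ycoordB subr_eq0 heightE hN ha.
suff -> : ycoord (Nm q (s x0) * a) = ycoord a * Nm q (s x0) by [].
by rewrite /ycoord mulrCA [LHS]TrZ ?Nm_Fq // [LHS]mulrC.
Qed.

(** Off 0 the height takes only two values in F_3, and its level through 1 is exactly [yfix]. *)
Lemma height_order3 x : q = 3 -> x != 0 ->
  height x = height 1 * (-1) ^+ (x \notin yfix).
Proof.
move=> q3 x0; case: (boolP (x \in yfix)) => xM.
  by rewrite mulr1; move: xM; rewrite yfixE => /(height_scales 1); rewrite n1mul.
have h1 := height_neq0 (oner_neq0 F); have hx := height_neq0 x0.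
have : height x / height 1 \in Fq by rewrite Fq_div ?height_ovoidal.1.
move/(Fq_order3 q3) => [] rE; move: (divfK h1 (height x)); rewrite rE.
- by rewrite mul0r => /esym/eqP; rewrite (negPf hx).
- by rewrite mul1r => /esym/level1_yfix xM'; rewrite xM' in xM.
- by rewrite mulrC => <-.
Qed.

(** For q = 3 the norm exponent q + 1 and the Euler exponent are both 4, so the norm is the
    quadratic character. *)
Lemma Nm_order3 (x : F) : q = 3 -> x != 0 -> Nm q x = (-1) ^+ (~~ is_square x).
Proof.
by move=> q3 x0; rewrite -Euler_pm // /Nm /euler_exp q3.
Qed.

Lemma proj_equiv_order3 : q = 3 -> proj_equiv q (stdU A) (model_unital q eps).
Proof.
move=> q3; have h4 : euler_exp = 4%N by rewrite /euler_exp q3.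
have c4 : #|yfix| = 4%N by rewrite card_dil.1 q3.
have [sqM|nsqM] := boolP (yfix \subset [set x | is_square x]).
  have AE : A = [set (idfun z.1, idfun z.2) | z in A].
    apply/setP => -[x y]; apply/idP/imsetP => [xyA|[[x' y'] zA [-> ->]]] //.
    by exists (x, y).
  rewrite AE; apply: normal_form_equiv => // x.
  have [->|x0] := eqVneq x 0.
    by rewrite height0 /Nm expr0n /= mulr0.
  rewrite height_order3 // Nm_order3 //; congr (_ * (-1) ^+ (~~ _)).
  (* Four squares exhaust the fourth roots of unity. *)
  suff -> : yfix = [set x | x ^+ 4 == 1] by rewrite inE is_squareE // h4.
  apply: eq_of_subset_leq_card; last by rewrite c4; apply: card_exp_le.
  apply/subsetP => c cM; rewrite inE -h4 -is_squareE ?yfix_neq0 //.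
  by have := subsetP sqM c cM; rewrite inE.
have [y yM y2] : exists2 y, y \in yfix & y ^+ 2 = 1 - y.
  have /subsetPn[y yM] := nsqM; rewrite inE => nsq.
  have yN : - y \in yfix.
    by have := yfixM yM (_ : -1 \in yfix); rewrite nmulrN nmul1 yfixE scalesN1; apply.
  have y4 : y ^+ 4 = -1 by rewrite -h4 Euler_pm ?yfix_neq0 // nsq.
  (* In characteristic 3 the polynomial X^4 + 1 splits into X^2 + X - 1 and X^2 - X - 1, which the
     change of sign of X exchanges. *)
  have : (y ^+ 2 - (1 - y)) * (y ^+ 2 - (1 + y)) = 0.
    transitivity (y ^+ 4 + 1 - 3 * y ^+ 2); first by ring.
    by rewrite y4 char_order9 //; ring.
  move/eqP; rewrite mulf_eq0 !subr_eq0 => /orP[]/eqP yE; first by exists y.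
  by exists (- y); rewrite // sqrrN yE opprK.
have NyM : - y \in yfix.
  by have := yfixM yM (_ : -1 \in yfix); rewrite nmulrN nmul1 yfixE scalesN1; apply.
have N1M : -1 \in yfix by rewrite yfixE scalesN1.
have sub : [set 1; -1; y; - y] \subset yfix.
  by apply/subsetP => z; rewrite !in_setU !in_set1 -!orbA => /or4P[]/eqP->; rewrite ?yfix1.
have yfE : yfix = [set 1; -1; y; - y].
  by apply/esym/eq_of_subset_leq_card => //; rewrite c4 card_order9_subgroup.
have s_inj := quat_aut_inj q3 y2.
apply: (proj_equiv_trans (proj_equiv_ext A s_inj s_inj s_inj _)).
  move=> k c; exists (quat_aut y c) => x.
  by rewrite quat_autD quat_autM.
apply: normal_form_equiv.
- exact: quat_autD.
- exact: quat_autZ.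
- exact: quat_aut_inj.
move=> x; have [->|x0] := eqVneq x 0.
  by rewrite height0 quat_aut0 /Nm expr0n /= mulr0.
rewrite height_order3 // Nm_order3 ?quat_aut_eq0 //.
by rewrite is_square_quat_aut // yfE.
Qed.

Lemma normalised_equiv : proj_equiv q (stdU A) (model_unital q eps).
Proof.
have [q3|q_neq3] := eqVneq q 3%N; first exact: proj_equiv_order3.
have q_gt3 : (3 < q)%N by rewrite ltn_neqAle eq_sym q_neq3 q_ge3.
have -> : A = [set (idfun z.1, idfun z.2) | z in A].
  apply/setP => -[x y]; apply/idP/imsetP => [xyA|[[x' y'] zA [-> ->]]] //.
  by exists (x, y).
by apply: normal_form_equiv => // x; apply: height_norm_gt3.
Qed.
End Normalised.

(** * Assembling the classification *)

Lemma affine_unital_equiv (A : {set F * F}) (eps : F) :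
  eps != 0 -> eps ^+ q = - eps -> affine_unital A ->
  #|stab A| = (q * (q ^ 2 - 1))%N ->
  proj_equiv q (stdU A) (model_unital q eps).
Proof.
move=> eps0 epsq Aun cA; have [B [AB Bun B00 vB hB]] := stab_normalised Aun cA.
have [w wV w0] := exists_Vnz Bun B00.
apply: proj_equiv_trans AB _.
exact: (normalised_equiv Bun B00 vB hB eps0 epsq wV w0).
Qed.

Lemma parabolic_equiv (U : {set point F}) (eps : F) :
  eps != 0 -> eps ^+ q = - eps -> parabolic_unital q U -> inf_vert F \in U ->
  #|Aut_set q U :&: linear_collineations q F| = (q * (q ^ 2 - 1))%N ->
  proj_equiv q U (model_unital q eps).
Proof.
move=> eps0 epsq [unU tU] Uv; rewrite (stdU_affine_part Uv tU) in unU *.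
rewrite card_stab => cA; apply: affine_unital_equiv => //.
exact: unital_stdU.
Qed.
End Nearfield.

Theorem theorem9p6 (p e q : nat) (F : finFieldType)
    (hp : prime p) (hp_odd : odd p) (he : (1 <= e)%N)
    (hq : q = (p ^ e)%N) (hF : #|F| = (q ^ 2)%N)
    (U : {set point F})
    (hU : parabolic_unital q U)
    (hbase : inf_vert F \in U \/ inf_point (0 : F) \in U)
    (hord : #|Aut_set q U :&: linear_collineations q F| = (q * (q ^ 2 - 1))%N)
    (eps : F) (heps0 : eps != 0) (heps : eps ^+ q = - eps) :
  proj_equiv q U (model_unital q eps).
Proof.
case: hbase => [Uv|U0]; first exact: (parabolic_equiv hp hp_odd he hq hF).
(* The exchange of coordinates carries (1, 0, 0) to (0, 1, 0). *)
pose s := swap hp hp_odd he hq hF.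
apply: (@proj_equiv_trans _ _ _ (s @: U)).
  by exists s; first exact: swap_collineation.
apply: (parabolic_equiv hp hp_odd he hq hF) => //.
- exact: parabolic_swap.
- apply/imsetP; exists (inf_point 0) => //.
  by rewrite swapE swap_inf eqxx.
- by rewrite card_linear_swap.
Qed.
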